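(* Let $X$ be a general (real-valued, not necessarily one-sided) Lévy process with $X_0=0$, and let $T\sim\mathrm{ME}(\boldsymbol\alpha,\mathbf T,\mathbf t)$ be independent of $X$, where $\mathbf T\in\mathbb R^{p\times p}$ has all eigenvalues in $\{z\in\mathbb C:\Re(z)<0\}$. Then for Borel sets $A,B\subset[0,\infty)$ we have \begin{align*} &\mathbb P(\overline X_T\in A,\ \overline X_T-X_T\in B)=\mathbb P(X_T-\underline X_T\in A,\ -\underline X_T\in B)\\ &\quad=\Big[\boldsymbol\alpha\int_0^\infty e^{\mathbf Tt}\,\mathbb P(\overline X_t\in A)\,\mathrm dt\Big]\cdot\Big[\int_0^\infty e^{\mathbf Tt}\,\mathbb P(-\underline X_t\in B)\,\mathrm dt\,(-\mathbf T)\mathbf t\Big], \end{align*} where both bracketed terms are, as functions of $A$ and $B$ respectively, finite vector-valued signed measures.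
   Context: $\overline X_t=\sup_{s\le t}X_s$ and $\underline X_t=\inf_{s\le t}X_s$. $T\sim\mathrm{ME}(\boldsymbol\alpha,\mathbf T,\mathbf t)$ means that the positive random variable $T$ has density $\boldsymbol\alpha e^{\mathbf Tx}\mathbf t$, $x\ge0$, with $\boldsymbol\alpha$ a real row vector of length $p$, $\mathbf T\in\mathbb R^{p\times p}$, $\mathbf t$ a real column vector. $T$ may be defective, i.e. $\mathbb P(T<\infty)=\boldsymbol\alpha(-\mathbf T)^{-1}\mathbf t\in(0,1]$; then all probabilities are understood as restricted to the event $\{T<\infty\}$. *)

(* Defs.v *)
From HB Require Import structures.
From mathcomp Require Import all_boot all_order all_algebra.
From mathcomp Require Import all_classical all_reals all_analysis.
From mathcomp Require Import measurable_realfun.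
From mathcomp.real_closed Require Import complex.

Set Implicit Arguments.
Unset Strict Implicit.
Unset Printing Implicit Defensive.

Import Order.TTheory GRing.Theory Num.Theory.
Import numFieldNormedType.Exports.

Local Open Scope classical_set_scope.
Local Open Scope ring_scope.

Section Independence.
Context {d : measure_display} {Omega : measurableType d} {R : realType}.

Definition sigma_process (X : R -> Omega -> R) (I : set R) : set (set Omega) :=
  <<s \bigcup_(t in I) preimage_set_system setT (X t) measurable >>.

Definition independent_systems (P : probability Omega R)
    (F G : set (set Omega)) : Prop :=
  forall E H, F E -> G H -> P (E `&` H) = (P E * P H)%E.

End Independence.

Section Levy.
Context {d : measure_display} {Omega : measurableType d} {R : realType}.

(* Time is [0, +oo[; the values of X at negative indices are irrelevant. *)
Record levy_process (P : probability Omega R) (X : R -> Omega -> R) : Prop :=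
  LevyProcess {
    levy_measurable : forall t : R, 0 <= t -> measurable_fun setT (X t) ;
    levy_start : forall w, X 0 w = 0 ;
    levy_right_cont : forall w (t : R), 0 <= t -> X s w @[s --> t^'+] --> X t w ;
    levy_left_lim : forall w (t : R), 0 < t -> cvg (X s w @[s --> t^'-]) ;
    levy_indep_incr : forall s t : R, 0 <= s -> s <= t ->
      independent_systems P (sigma_process X `[0, s])
        (preimage_set_system setT (X t \- X s) measurable) ;
    levy_stat_incr : forall s t : R, 0 <= s -> s <= t ->
      forall C : set R, measurable C ->
        P ((X t \- X s) @^-1` C) = P (X (t - s) @^-1` C) }.

(* Right-continuous paths with left limits are bounded on [0, t], so these
   real suprema and infima are the genuine ones. *)
Definition run_sup (X : R -> Omega -> R) (t : R) (w : Omega) : R :=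
  sup [set X s w | s in `[0, t]].

Definition run_inf (X : R -> Omega -> R) (t : R) (w : Omega) : R :=
  inf [set X s w | s in `[0, t]].

Definition independent_of_process (P : probability Omega R)
    (X : R -> Omega -> R) (tau : Omega -> \bar R) : Prop :=
  independent_systems P (sigma_process X `[0, +oo[)
    (preimage_set_system setT tau measurable).

End Levy.

Section MatrixExponential.
Context {R : realType} {p : nat}.

Definition expmx (A : 'M[R]_p) : 'M[R]_p :=
  limn (series (fun k : nat => (k`!%:R)^-1 *: A ^+ k)).

(* Eigenvalues are the complex ones. *)
Definition stable_mx (T : 'M[R]_p) : Prop :=
  forall z : R[i]%C,
    eigenvalue (map_mx (real_complex R) T) z -> complex.Re z < 0.

Definition me_density (alpha : 'rV[R]_p) (T : 'M[R]_p) (t : 'cV[R]_p)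
    (x : R) : R :=
  (alpha *m expmx (x *: T) *m t) 0 0.

(* The mass missing from the density sits at +oo (defective case). *)
Record matrix_exponential_time d (Omega : measurableType d)
    (P : probability Omega R) (tau : Omega -> \bar R)
    (alpha : 'rV[R]_p) (T : 'M[R]_p) (t : 'cV[R]_p) : Prop :=
  MatrixExponentialTime {
    me_measurable : measurable_fun setT tau ;
    me_positive : forall w, (0 < tau w)%E ;
    me_density_ge0 : forall x : R, 0 <= x -> 0 <= me_density alpha T t x ;
    me_law : forall C : set R, measurable C ->
      P [set w | exists2 x, tau w = x%:E & C x] =
      (\int[lebesgue_measure]_(x in C `&` `[0%R, +oo[)
         (me_density alpha T t x)%:E)%E ;
    me_nontrivial : (0 < P [set w | (tau w < +oo)%E])%E }.

(* The entrywise integral of exp(T u) f(u) over u >= 0. *)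
Definition exp_transform (T : 'M[R]_p) (f : R -> R) : 'M[R]_p :=
  \matrix_(i, j) Rintegral lebesgue_measure `[0, +oo[
    (fun u => expmx (u *: T) i j * f u).

Definition exp_transform_converges (T : 'M[R]_p) (f : R -> R) : Prop :=
  forall i j, lebesgue_measure.-integrable `[0, +oo[
    (fun u => (expmx (u *: T) i j * f u)%:E).

End MatrixExponential.

(* A charge only takes finite values, so on D this says that nu is a finite
   signed measure; a measure on the Borel subsets of a Borel set D extends to
   the line by A |-> nu (A `&` D). *)
Definition finite_signed_measure_on (R : realType) (D : set R)
    (nu : set R -> R) : Prop :=
  exists mu : {charge set R -> \bar R},
    forall A : set R, measurable A -> A `<=` D -> mu A = (nu A)%:E.

Section Brackets.
Context {d : measure_display} {Omega : measurableType d} {R : realType}.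
Context {p : nat}.

Definition sup_prob (P : probability Omega R) (X : R -> Omega -> R)
    (A : set R) (u : R) : R :=
  fine (P [set w | A (run_sup X u w)]).

Definition neg_inf_prob (P : probability Omega R) (X : R -> Omega -> R)
    (B : set R) (u : R) : R :=
  fine (P [set w | B (- run_inf X u w)]).

Definition sup_bracket (P : probability Omega R) (X : R -> Omega -> R)
    (alpha : 'rV[R]_p) (T : 'M[R]_p) (A : set R) : 'rV[R]_p :=
  alpha *m exp_transform T (sup_prob P X A).

Definition inf_bracket (P : probability Omega R) (X : R -> Omega -> R)
    (T : 'M[R]_p) (t : 'cV[R]_p) (B : set R) : 'cV[R]_p :=
  exp_transform T (neg_inf_prob P X B) *m (- T) *m t.

End Brackets.

(* Main.v *)
Require Import Defs.
From HB Require Import structures.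
From mathcomp Require Import all_boot all_order all_algebra.
From mathcomp Require Import all_classical all_reals all_analysis.
From mathcomp Require Import measurable_realfun.
From mathcomp.real_closed Require Import complex.
From mathcomp Require Import ring lra zify.

(** Sample X along the grid of mesh d.  Splitting the walk at the first index
    where its maximum is attained, independence of the increments gives
    P(max in A, max - end in B) at step n as a convolution a(A) * b(B), where
    a(A) concerns ascending records and b(B) walks that stay below 0, and
    a(everything) * b(everything) = 1.  Since reversing the increments turns
    max - end into - min, commutativity of convolution yields the identity
    F_0(A, B) + ... + F_n(A, B) = sum_j G_j(A) H_(n-j)(B) between the laws F of
    (max, max - end), G of max and H of - min.  Multiplied by powers of
    E = e^(T d) and summed by parts, this says that
    (alpha sum_j E^j G_j) (sum_k E^k H_k (1 - E) t) equals
    sum_m (alpha E^m t) F_m, the discrete form of the theorem.  The mesh is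
    then refined, with truncation at the time horizon 1 / d, for half-lines A
    and B away from countably many atoms, and the equality extends to Borel
    sets by a pi-lambda argument in each variable. *)

(** For p > 1 a matrix-exponential density need not be a mixture of exponential ones and the
    brackets may be signed, so no independence of the maximum and the drawdown at [tau] is at hand.
    What remains is the identity between convolutions: it is free of the weights and can be summed
    against any sequence. Powers of E fit since E^j E^k (1 - E) depends on j + k alone and
    telescopes; the factor [- T] is the limit of (1 - E) / d.

    Mesh 1 / (n + 1) and horizon n + 1 give N = (n + 1)^2 steps. Cutting the double sum to a square
    costs 3 N^2 times the weights past the horizon; times the mesh, this is a cube against an
    exponential. Such decay of e^(u T) has to be drawn from a condition on eigenvalues only, which
    is done with Cayley-Hamilton and the powers of 1 + h T.

    Grid maxima converge path by path. Laws then converge on half-lines whose end point is not an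
    atom and, inside the brackets, at all but countably many times; this is why countable sets of
    levels and times are excluded throughout. *)

Set Implicit Arguments.
Unset Strict Implicit.
Unset Printing Implicit Defensive.

Import Order.TTheory GRing.Theory Num.Theory.
Import numFieldNormedType.Exports.
Import Normc.

Local Open Scope classical_set_scope.
Local Open Scope ring_scope.

(** * Geometric decay of matrix powers *)

Section PowerDecay.
Context {R : realType}.

(** Comparison with a supersolution: D r^k dominates as soon as x_0 <= D and m D + C <= r D, and D =
    x_0 + C / (r - m) meets both. The strict gap between [m] and [r] avoids a polynomial factor. *)
Lemma geometric_recurrence (x : nat -> R) (m r C : R) :
  0 <= m -> m < r -> 0 <= C -> 0 <= x 0 ->
  (forall k, x k.+1 <= m * x k + C * r ^+ k) ->
  exists D, forall k, x k <= D * r ^+ k.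
Proof.
move=> m0 mr C0 x0 xS; have rm : 0 < r - m by rewrite subr_gt0.
exists (x 0 + C / (r - m)); elim=> [|k IH].
  by rewrite expr0 mulr1 lerDl divr_ge0 // ltW.
set D := x 0 + _ in IH *.
have CD : C <= D * (r - m).
  by rewrite mulrDl divfK ?gt_eqF// lerDr mulr_ge0 // ltW.
apply: (le_trans (xS k)).
apply: (@le_trans _ _ (m * (D * r ^+ k) + D * (r - m) * r ^+ k)).
  apply: lerD; first exact: ler_wpM2l.
  by apply: ler_wpM2r => //; rewrite exprn_ge0 // ltW // (le_lt_trans m0).
by rewrite exprS [leLHS](_ : _ = D * (r * r ^+ k)) //; ring.
Qed.

Lemma normc_ge0 (z : R[i]) : 0 <= normc z.
Proof. by case: z => a b; exact: sqrtr_ge0. Qed.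

(** For z = a + ib, |1 + h z|^2 = 1 + 2 h a + h^2 (a^2 + b^2), which is below 1 for all small h > 0
    when a < 0. A single [h] has to serve the whole list, hence a minimum over its elements. *)
Lemma contraction_step (s : seq R[i]) :
  (forall z, z \in s -> complex.Re z < 0) ->
  exists2 h0 : R, 0 < h0 & forall h, 0 < h -> h <= h0 ->
    exists r, [/\ 0 < r, r < 1 &
      forall z, z \in s -> normc (1 + h%:C%C * z) < r].
Proof.
elim: s => [|z s IH] sP.
  by exists 1 => // h _ _; exists (2^-1); split => //; rewrite ?invr_gt0// invf_lt1 // ltr1n.
have [h0 h0p H] := IH (fun y ys => sP y (mem_behead (s := z :: s) ys)).
have z0 : complex.Re z < 0 by apply: sP; rewrite mem_head.
case: z z0 sP => a b /= a0 sP.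
have q0 : 0 < a ^+ 2 + b ^+ 2 by nra.
(* Half of the critical step -2a / (a^2 + b^2), so that a weak bound on [h] still gives a strict
   contraction. *)
exists (Num.min h0 (- a / (a ^+ 2 + b ^+ 2))).
  by rewrite lt_min h0p divr_gt0 // oppr_gt0.
move=> h hp; rewrite le_min => /andP[hh0]; rewrite ler_pdivlMr // => hq.
have [r [r0 r1 rs]] := H h hp hh0.
have n1 : normc (1 + h%:C%C * (a +i* b)%C) < 1.
  rewrite /normc /=; rewrite -[ltRHS]sqrtr1 ltr_sqrt //; nra.
exists (Num.max r ((normc (1 + h%:C%C * (a +i* b)%C) + 1) / 2)); split.
- by rewrite lt_max r0.
- by rewrite gt_max r1 /= midf_lt.
- move=> y; rewrite inE => /orP[/eqP ->|ys]; rewrite lt_max; last by rewrite rs.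
  by rewrite midf_lt // orbT.
Qed.

(** With B = 1 + h T one has B = (1 + h z) + h (T - z). Hence B^k Q' obeys a recurrence of ratio 1 +
    h z, forced by B^k (T - z) Q'. Removing one linear factor at a time carries decay from the
    vanishing product to [Q], in place of a Jordan form. *)
Lemma factor_powers_decay (p : nat) (T : 'M[R[i]]_p) (h r : R) (s : seq R[i])
    (Q : 'M[R[i]]_p) :
  0 < h -> 0 < r ->
  (forall z, z \in s -> normc (1 + h%:C%C * z) < r) ->
  \prod_(z <- s) (T - z%:M) * Q = 0 ->
  forall i j, exists D, forall k,
    normc (((1 + h%:C%C *: T) ^+ k * Q) i j) <= D * r ^+ k.
Proof.
move=> h0 r0; set B := 1 + _.
suff main : forall s Q, (forall z, z \in s -> normc (1 + h%:C%C * z) < r) ->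
  (forall i j, exists D, forall k,
    normc ((B ^+ k * (\prod_(z <- s) (T - z%:M) * Q)) i j) <= D * r ^+ k) ->
  forall i j, exists D, forall k, normc ((B ^+ k * Q) i j) <= D * r ^+ k.
  move=> sr sQ0; apply: main sr _ => i j; exists 0 => k.
  by rewrite sQ0 mulr0 mxE mul0r normc0.
elim=> [|z {}s IH] {}Q sr; first by rewrite big_nil mul1r.
rewrite big_cons -mulrA => H.
apply: IH => [y ys|i j]; first by apply: sr; rewrite inE ys orbT.
set Q' := _ * Q in H *; have [D HD] := H i j.
have zr : normc (1 + h%:C%C * z) < r by apply: sr; rewrite mem_head.
have D0 : 0 <= D.
  have := HD 0; rewrite expr0 mulr1; apply: le_trans; exact: normc_ge0.
apply: (@geometric_recurrence _ (normc (1 + h%:C%C * z)) r (h * D)) => //.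
- exact: normc_ge0.
- by rewrite mulr_ge0 // ltW.
- exact: normc_ge0.
move=> k.
have -> : B ^+ k.+1 * Q' =
    (1 + h%:C%C * z) *: (B ^+ k * Q') + h%:C%C *: (B ^+ k * ((T - z%:M) * Q')).
  rewrite scalerDl scale1r -addrA exprSr -mulrA {2}/B mulrDl mul1r mulrDr.
  rewrite -scalerA -scalerDr -mulmxE -!scalemxAl -!scalemxAr.
  by congr (_ + _ *: _); rewrite mulmxBl mulmxBr mul_scalar_mx -scalemxAr addrC subrK.
rewrite mxE [X in X + _]mxE [X in _ + X]mxE (le_trans (le_normcD _ _)) // !normcM lerD //.
rewrite -mulrA ler_pM ?HD ?normc_ge0 //.
by rewrite /normc /= expr0n addr0 sqrtr_sqr gtr0_norm.
Qed.

(* Uniformization: the powers of [1 + h T] decay geometrically once every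
   eigenvalue [z] satisfies [|1 + h z| < 1], which holds for small [h > 0]. *)
Lemma stable_powers_decay (p : nat) (T : 'M[R]_p) : stable_mx T ->
  exists h r : R, [/\ 0 < h, 0 < r, r < 1 &
    forall i j, exists D, forall k, `|((1 + h *: T) ^+ k) i j| <= D * r ^+ k].
Proof.
case: p T => [|p] T sT; first by exists 1, 2^-1; split=> //; [lra|by case].
set CT := map_mx (real_complex R) T.
have [s sE] := closed_field_poly_normal (char_poly CT).
rewrite (monicP (char_poly_monic _)) scale1r in sE.
have sRe z : z \in s -> complex.Re z < 0.
  by move=> zs; apply: sT; rewrite eigenvalue_root_char sE root_prod_XsubC.
have [h hp H] := contraction_step sRe.
have [r [r0 r1 rs]] := H h hp (lexx _).
exists h, r; split => // i j.
(* The characteristic polynomial splits over the complex numbers with roots [s], so this is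
   Cayley-Hamilton. *)
have P0 : \prod_(z <- s) (CT - z%:M) * 1 = 0.
  rewrite mulr1 -(Cayley_Hamilton CT) sE rmorph_prod /=.
  by apply: eq_bigr => z _; rewrite rmorphB /= horner_mx_X horner_mx_C.
have [D HD] := factor_powers_decay hp r0 rs P0 i j.
exists D => k; apply: le_trans (HD k).
have -> : 1 + h%:C%C *: CT = map_mx (real_complex R) (1 + h *: T).
  by rewrite map_mxD map_mx1 map_mxZ.
rewrite mulr1 -rmorphXn /= mxE.
by rewrite /normc /= expr0n addr0 sqrtr_sqr.
Qed.

End PowerDecay.

(** * The matrix exponential *)

Lemma cvg_sum_seq {R : realType} (I : Type) (r : seq I) (f : I -> nat -> R) (l : I -> R) :
  (forall i, f i n @[n --> \oo] --> l i) ->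
  \sum_(i <- r) f i n @[n --> \oo] --> \sum_(i <- r) l i.
Proof. by move=> fl; apply: cvg_big => // -[x y]; exact: add_continuous. Qed.

Section ExponentialGeneratingFunction.
Context {R : realType}.
Implicit Types (c : nat -> R) (x C K : R).

(** The exponential generating function of [c]. Differentiation shifts the sequence, so calculus on
    entries of the matrix exponential reduces to scalar power series. *)
Definition egf c x : R := limn (pseries (fun k => (k`!%:R)^-1 * c k) x).

Lemma egf_normed_cvg c C K x : (forall k, `|c k| <= C * K ^+ k) -> 0 <= K ->
  cvgn [normed series (fun k => (k`!%:R)^-1 * c k * x ^+ k)] /\
  limn [normed series (fun k => (k`!%:R)^-1 * c k * x ^+ k)] <= C * expR (K * `|x|).
Proof.
move=> cK K0.
have C0 : 0 <= C by have := cK 0; rewrite expr0 mulr1; apply: le_trans.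
have le k : `|(k`!%:R)^-1 * c k * x ^+ k| <= C * exp_coeff (K * `|x|) k.
  rewrite /exp_coeff /= !normrM normrX exprMn normfV normr_nat.
  rewrite [leRHS](_ : _ = (k`!%:R)^-1 * (C * K ^+ k) * `|x| ^+ k); last by ring.
  by rewrite ler_wpM2r ?exprn_ge0 // ler_wpM2l // invr_ge0.
have cE : cvgn (series (C *: exp_coeff (K * `|x|))) :=
  @is_cvg_seriesZ _ _ C (is_cvg_series_exp_coeff _).
have cN : cvgn [normed series (fun k => (k`!%:R)^-1 * c k * x ^+ k)].
  apply: series_le_cvg cE => // k; first exact: normr_ge0.
  by rewrite mulr_ge0 // exp_coeff_ge0 // mulr_ge0.
split => //; apply: le_trans (lim_series_le cN cE le) _.
by rewrite lim_seriesZ //; exact: is_cvg_series_exp_coeff.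
Qed.

Lemma egf_cvg c C K x : (forall k, `|c k| <= C * K ^+ k) -> 0 <= K ->
  pseries (fun k => (k`!%:R)^-1 * c k) x @ \oo --> egf c x.
Proof.
by move=> cK K0; have [+ _] := egf_normed_cvg x cK K0; exact: (@normed_cvg _ R^o).
Qed.

Lemma egf_bound c C K x : (forall k, `|c k| <= C * K ^+ k) -> 0 <= K ->
  `|egf c x| <= C * expR (K * `|x|).
Proof.
move=> cK K0; have [cN le] := egf_normed_cvg x cK K0.
exact: le_trans (@lim_series_norm _ R^o _ cN) le.
Qed.

Lemma egf0 c : egf c 0 = c 0.
Proof.
apply: lim_near_cst => //; near=> m; rewrite -[m]prednK; last by near: m.
rewrite /pseries /series /= big_nat_recl // big1_seq ?addr0.
  by rewrite fact0 invr1 mul1r expr0 mulr1.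
by move=> i _; rewrite exprS mul0r mulr0.
Unshelve. all: by end_near. Qed.

(** Termwise, (k + 1) / (k + 1)! = 1 / k!. The criterion for differentiating wants the series and
    its first two formal derivatives to converge at a point beyond x, here |x| + 1; a shift of [c]
    keeps the ratio [K] and only changes the constant. *)
Lemma is_derive_egf c C K x : (forall k, `|c k| <= C * K ^+ k) -> 0 <= K ->
  is_derive x 1 (egf c) (egf (c \o succn) x).
Proof.
move=> cK K0.
have shift (e : nat -> R) C' : (forall k, `|e k| <= C' * K ^+ k) ->
    forall k, `|(e \o succn) k| <= (C' * K) * K ^+ k.
  by move=> eK k; rewrite -mulrA -exprS; exact: eK.
have diffsE (e : nat -> R) : pseries_diffs (fun k => (k`!%:R)^-1 * e k) =
    fun k => (k`!%:R)^-1 * (e \o succn) k.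
  apply/funext => k; rewrite /pseries_diffs factS natrM invfM /=.
  by rewrite !mulrA mulfV ?pnatr_eq0 // mul1r.
rewrite /egf -diffsE; apply: (@pseries_snd_diffs _ _ (`|x| + 1)).
- by apply/cvg_ex; eexists; exact: egf_cvg cK K0.
- by rewrite diffsE; apply/cvg_ex; eexists; exact: egf_cvg (shift _ _ cK) K0.
- rewrite 2!diffsE; apply/cvg_ex; eexists; exact: egf_cvg (shift _ _ (shift _ _ cK)) K0.
- by rewrite [ltRHS]ger0_norm ?addr_ge0 // ltrDl.
Qed.

Lemma egf_sum (n : nat) (a : 'I_n -> R) (c : 'I_n -> nat -> R) (C : 'I_n -> R) K x :
  (forall l k, `|c l k| <= C l * K ^+ k) -> 0 <= K ->
  egf (fun k => \sum_l a l * c l k) x = \sum_l a l * egf (c l) x.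
Proof.
move=> cK K0; apply/cvg_lim => //.
rewrite [X in X @ _](_ : _ =
    fun m => \sum_l a l * pseries (fun k => (k`!%:R)^-1 * c l k) x m).
  apply: cvg_sum_seq => l; apply: cvgMl_tmp.
  exact: egf_cvg (cK l) K0.
apply/funext => m; rewrite /pseries /series /=.
under [RHS]eq_bigr do rewrite mulr_sumr.
rewrite exchange_big; apply: eq_bigr => k _.
rewrite mulr_sumr mulr_suml; apply: eq_bigr => l _; ring.
Qed.

End ExponentialGeneratingFunction.

Section MatrixExponentialTheory.
Context {R : realType} {p : nat}.
Implicit Types (T : 'M[R]_p) (u x : R).

Lemma cvg_mx_entries (F : nat -> 'M[R]_p) (L : 'M[R]_p) :
  (forall i j, F n i j @[n --> \oo] --> L i j) -> F @ \oo --> L.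
Proof.
move=> FL; apply/cvgrPdist_le => e e0; near=> n.
rewrite [leLHS]/Num.Def.normr/= mx_normrE (bigmax_le _ (ltW e0))//= => ij _.
rewrite !mxE; move: ij; near: n; apply: filter_forall => /= ij.
exact: ((cvgrPdist_le _ _).1 (FL ij.1 ij.2)).
Unshelve. all: by end_near. Qed.

(** The sum of all |T i j| dominates every row sum, so it is a ratio that multiplies along. The
    factor 1 gives the bound the shape C K^k used for [egf]. *)
Lemma powers_bound T : exists2 K : R, 0 <= K &
  forall k i j, `|(T ^+ k) i j| <= 1 * K ^+ k.
Proof.
exists (\sum_i \sum_j `|T i j|).
  by apply: sumr_ge0 => i _; apply: sumr_ge0.
elim=> [|k IH] i j.
  by rewrite !expr0 !mxE; case: eqP => _; rewrite ?normr1 ?normr0 ?mulr1.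
rewrite exprS -mulmxE mxE (le_trans (ler_norm_sum _ _ _)) //.
rewrite mul1r exprS.
apply: (@le_trans _ _ (\sum_l `|T i l| * (\sum_i \sum_j `|T i j|) ^+ k)).
  by apply: ler_sum => l _; rewrite normrM ler_wpM2l // -[leRHS]mul1r IH.
rewrite -mulr_suml ler_wpM2r ?exprn_ge0 //.
  by apply: sumr_ge0 => l _; apply: sumr_ge0.
rewrite [leRHS](bigD1 i) //= lerDl; apply: sumr_ge0 => l _; exact: sumr_ge0.
Qed.

Lemma expmxE T u i j : expmx (u *: T) i j = egf (fun k => (T ^+ k) i j) u.
Proof.
have [K K0 TK] := powers_bound T.
rewrite /expmx.
suff -> : limn (series (fun k : nat => (k`!%:R)^-1 *: (u *: T) ^+ k)) =
    \matrix_(i, j) egf (fun k => (T ^+ k) i j) u by rewrite mxE.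
apply/cvg_lim; first exact: norm_hausdorff.
apply: cvg_mx_entries => a b; rewrite mxE.
rewrite [X in X @ _](_ : _ = pseries (fun k => (k`!%:R)^-1 * (T ^+ k) a b) u).
  by apply: egf_cvg K0 => k; exact: TK.
apply/funext => n; rewrite /pseries /series /= summxE; apply: eq_bigr => k _.
have -> : (u *: T) ^+ k = u ^+ k *: T ^+ k.
  elim: k => [|k IH]; first by rewrite !expr0 scale1r.
  by rewrite !exprS IH -!mulmxE -scalemxAl -scalemxAr scalerA.
by rewrite !mxE mulrA mulrAC.
Qed.

Lemma expmx0 T : expmx (0 *: T) = 1.
Proof. by apply/matrixP => i j; rewrite expmxE egf0 expr0. Qed.

Lemma is_derive_expmx_r T x i j :
  is_derive x 1 (fun u => expmx (u *: T) i j) ((expmx (x *: T) *m T) i j).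
Proof.
have [K K0 TK] := powers_bound T.
under eq_fun do rewrite expmxE.
rewrite [X in is_derive _ _ _ X](_ : _ = egf ((fun k => (T ^+ k) i j) \o succn) x).
  by apply: is_derive_egf K0 => k; exact: TK.
rewrite mxE; under eq_bigr do rewrite expmxE mulrC.
rewrite -(egf_sum (fun l => T l j) x (fun l k => TK k i l) K0).
congr egf; apply/funext => k /=; rewrite exprSr -mulmxE mxE.
by apply: eq_bigr => l _; rewrite mulrC.
Qed.

Lemma is_derive_expmx_l T x i j :
  is_derive x 1 (fun u => expmx (u *: T) i j) ((T *m expmx (x *: T)) i j).
Proof.
have [K K0 TK] := powers_bound T.
under eq_fun do rewrite expmxE.
rewrite [X in is_derive _ _ _ X](_ : _ = egf ((fun k => (T ^+ k) i j) \o succn) x).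
  by apply: is_derive_egf K0 => k; exact: TK.
rewrite mxE; under eq_bigr do rewrite expmxE.
rewrite -(egf_sum (T i) x (fun l k => TK k l j) K0).
by congr egf; apply/funext => k /=; rewrite exprS -mulmxE mxE.
Qed.

(** In the derivative of e^(-uT) Y(u) the terms -e^(-uT) T Y and e^(-uT) T Y cancel. The derivative
    of the exponential with [T] on the right makes this immediate, without commuting matrices. *)
Lemma linear_ode_cst T (Y : R -> 'M[R]_p) :
  (forall x i j, is_derive x 1 (fun u => Y u i j) ((T *m Y x) i j)) ->
  forall x, expmx ((- x) *: T) *m Y x = Y 0.
Proof.
move=> dY x; apply/matrixP => i j.
pose Z u := (expmx ((- u) *: T) *m Y u) i j.
have -> : Y 0 i j = Z 0 by rewrite /Z oppr0 expmx0 mul1mx.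
rewrite -[LHS]/(Z x).
apply: is_derive_0_is_cst => {}x; rewrite /Z.
under eq_fun do rewrite mxE.
have dE l : is_derive x 1 (fun u => expmx ((- u) *: T) i l)
    (- (expmx ((- x) *: T) *m T) i l).
  rewrite -mulN1r mulrC.
  apply: (@is_derive1_comp _ (fun u => expmx (u *: T) i l) (fun u => - u)).
    exact: is_derive_expmx_r.
have dS : is_derive x 1 (fun u => \sum_l expmx ((- u) *: T) i l * Y u l j)
    (\sum_l (expmx ((- x) *: T) i l *: (T *m Y x) l j +
             Y x l j *: (- (expmx ((- x) *: T) *m T) i l))).
  rewrite (_ : (fun u => _) = \sum_l (fun u => expmx ((- u) *: T) i l * Y u l j)).
    by apply: is_derive_sum => l; apply: is_deriveM.
  by apply/funext => u; rewrite fct_sumE.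
apply: (is_derive_eq dS); rewrite big_split /=.
rewrite [X in _ + X](_ : _ = - (expmx ((- x) *: T) *m T *m Y x) i j).
  rewrite -mulmxA mxE; apply/eqP; rewrite subr_eq0; apply/eqP.
  by apply: eq_bigr => l _.
rewrite [in RHS]mxE -sumrN; apply: eq_bigr => l _.
by rewrite /GRing.scale /= mulrN mulrC.
Qed.

Lemma linear_ode_unique T (Y : R -> 'M[R]_p) :
  (forall x i j, is_derive x 1 (fun u => Y u i j) ((T *m Y x) i j)) ->
  forall x, Y x = expmx (x *: T) *m Y 0.
Proof.
(* Applied to the exponential itself, constancy gives e^(-xT) e^(xT) = 1; a one-sided inverse of a
   square matrix is two-sided. *)
move=> dY x; have := linear_ode_cst (is_derive_expmx_l T) x.
rewrite expmx0 => /mulmx1C eK; rewrite -(linear_ode_cst dY x) mulmxA.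
by rewrite eK mul1mx.
Qed.

(** As a function of [x], the left side solves the same linear equation with initial value
    e^(yT). *)
Lemma expmxD T (x y : R) : expmx ((x + y) *: T) = expmx (x *: T) *m expmx (y *: T).
Proof.
rewrite -[in RHS](add0r y).
apply: (@linear_ode_unique T (fun x => expmx ((x + y) *: T))) => u i j.
rewrite -[(_ *m _) i j]mulr1.
apply: (@is_derive1_comp _ (fun u => expmx (u *: T) i j) (fun u => u + y)).
  exact: is_derive_expmx_l.
by apply: is_derive_eq; rewrite addr0.
Qed.

Lemma expmx_decay T : stable_mx T -> exists2 c : R, 0 < c &
  exists2 C : R, 0 <= C &
    forall i j u, 0 <= u -> `|expmx (u *: T) i j| <= C * expR (- c * u).
Proof.
move=> /stable_powers_decay[h [r [h0 r0 r1 HD]]].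
set A := 1 + h *: T in HD.
(* [e ^ (u T) = e ^ (- u / h) e ^ ((u / h) A)] since [T = (A - 1) / h]. *)
pose D i j := projT1 (cid (HD i j)).
have DP i j k : `|(A ^+ k) i j| <= D i j * r ^+ k.
  exact: (projT2 (cid (HD i j))).
have D0 i j : 0 <= D i j by have := DP i j 0; rewrite expr0 mulr1; apply: le_trans.
pose Y u : 'M[R]_p :=
  expR (- (u / h)) *: \matrix_(i, j) egf (fun k => (A ^+ k) i j) (u / h).
have YE u : Y u = expmx (u *: T).
  have Y0 : Y 0 = 1%:M.
    rewrite /Y mul0r oppr0 expR0 scale1r.
    by apply/matrixP => i j; rewrite mxE egf0 expr0.
  rewrite -[RHS]mulmx1 -Y0; apply: linear_ode_unique => {u} x i j.
  under eq_fun do rewrite !mxE.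
  have dh : is_derive x 1 (fun u : R => u / h) h^-1.
    rewrite (_ : (fun _ => _) = h^-1 \*: id); last first.
      by apply/funext => v; rewrite /= /GRing.scale /= mulrC.
    by apply: is_derive_eq; rewrite /GRing.scale /= mulr1.
  have d1 : is_derive x 1 (fun u => expR (- (u / h))) (expR (- (x / h)) * - h^-1).
    exact: (@is_derive1_comp _ expR (fun u => - (u / h))).
  have d2 : is_derive x 1 (fun u => egf (fun k => (A ^+ k) i j) (u / h))
      (egf ((fun k => (A ^+ k) i j) \o succn) (x / h) * h^-1).
    apply: (@is_derive1_comp _ (egf (fun k => (A ^+ k) i j)) (fun u => u / h)).
    by apply: (is_derive_egf _ (DP i j)); exact: ltW.
  apply: (is_derive_eq (is_deriveM d1 d2)).
  rewrite -scalemxAr !mxE.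
  have -> : egf ((fun k => (A ^+ k) i j) \o succn) (x / h) =
     \sum_l A i l * egf (fun k => (A ^+ k) l j) (x / h).
    rewrite -(egf_sum (A i) (x / h) (fun l => DP l j) (ltW r0)).
    by congr egf; apply/funext => k /=; rewrite exprS -mulmxE mxE.
  under eq_bigr do rewrite /A mxE mxE mulrDl.
  under [in RHS]eq_bigr do rewrite mxE.
  rewrite big_split /= (bigD1 i) //= big1 ?addr0; last first.
    by move=> l li; rewrite eq_sym (negbTE li) mul0r.
  rewrite eqxx mul1r /GRing.scale /=.
  under eq_bigr do rewrite mxE -mulrA.
  rewrite -mulr_sumr.
  have hN : h != 0 by rewrite gt_eqF.
  by field.
have b0 : 0 <= \sum_i \sum_j D i j.
  by apply: sumr_ge0 => i _; apply: sumr_ge0.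
(* The rate combines e^(-u/h) with the bound e^(r u/h) on the series in [A]; the constant sums over
   all entries to be uniform in them. *)
exists ((1 - r) / h); first by rewrite divr_gt0 // subr_gt0.
exists (\sum_i \sum_j D i j) => // i j u u0.
have hu : 0 <= u / h by rewrite divr_ge0 // ltW.
rewrite -YE !mxE normrM (ger0_norm (expR_ge0 _)).
apply: (@le_trans _ _ (expR (- (u / h)) * (D i j * expR (r * (u / h))))).
  rewrite ler_wpM2l ?expR_ge0 // -{2}(ger0_norm hu).
  exact: egf_bound (DP i j) (ltW r0).
rewrite mulrCA -expRD (_ : - (u / h) + _ = - ((1 - r) / h) * u); last by ring.
rewrite ler_wpM2r ?expR_ge0 // (bigD1 i) //= (bigD1 j) //= -addrA lerDl.
by rewrite addr_ge0 // sumr_ge0 // => l _; exact: sumr_ge0.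
Qed.

End MatrixExponentialTheory.

(** * Right-continuous paths with left limits *)

Section CadlagPaths.
Context {R : realType}.
Variable x : R -> R.
Hypothesis rc : forall t : R, 0 <= t -> x s @[s --> t^'+] --> x t.
Hypothesis ll : forall t : R, 0 < t -> cvg (x s @[s --> t^'-]).

Lemma right_cont_eps t e : 0 <= t -> 0 < e ->
  exists2 d, 0 < d & forall s, t < s -> s < t + d -> `|x t - x s| < e.
Proof.
move=> t0 e0; have /cvgrPdist_lt/(_ e e0)/= := rc t0.
rewrite near_withinE => /nbhs_ballP[d /= d0 H].
exists d => // s ts std; apply: (H s) => //.
by rewrite /ball /= ltr_distlC; apply/andP; split => //; lra.
Qed.

Lemma cadlag_locally_bounded t : 0 <= t ->
  exists2 d, 0 < d & exists B, forall s, 0 <= s -> t - d < s -> s < t + d -> x s <= B.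
Proof.
move=> t0; have [d d0 H] := right_cont_eps t0 ltr01.
have [d' d'0 [B' H']] : exists2 d', 0 < d' &
    exists B', forall s, 0 <= s -> t - d' < s -> s < t -> x s <= B'.
  have [t1|t1] := ltP 0 t; last by exists 1 => //; exists 0 => s s0 _ st; lra.
  have /cvgrPdist_lt/(_ 1 ltr01)/= := ll t1.
  set l := lim _; rewrite near_withinE => /nbhs_ballP[d' /= d'0 H'].
  exists d' => //; exists (l + 1) => s s0 sd st.
  have : ball t d' s by rewrite /ball /= ltr_distlC; apply/andP; split => //; lra.
  by move=> /H'/(_ st); rewrite ltr_distlC => /andP[_ /ltW].
exists (Num.min d d'); first by rewrite lt_min d0.
exists (Num.max B' (x t + 1)) => s s0 sl sr; rewrite le_max.
have : Num.min d d' <= d /\ Num.min d d' <= d' by rewrite !ge_min !lexx orbT.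
move=> [md md']; have [st|st|->] := ltgtP s t.
- by rewrite H' //; lra.
- have := H s st (lt_le_trans sr _); rewrite ltr_distlC => Hs.
  by apply/orP; right; have /andP[_ /ltW ->] := Hs ltac:(lra).
- by apply/orP; right; lra.
Qed.

(** [sup] of an unbounded set is a default value, so this bound is what makes [path_sup] an upper
    bound of the path. *)
Lemma cadlag_bounded u : exists M, forall s, 0 <= s -> s <= u -> x s <= M.
Proof.
have := @segment_compact R 0 u; rewrite compact_near_coveringP => cov.
(* Compactness in its covering form, with the bound [M] tending to +oo as parameter: local bounds
   become a uniform one. *)
have [t|M HM] := cov R (pinfty_nbhs R) (fun M s => 0 <= s -> s <= u -> x s <= M) _.
  rewrite /= in_itv /= => /andP[t0 _].
  have [d d0 [B H]] := cadlag_locally_bounded t0.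
  exists (ball t d, [set M | B < M]) => /=.
    by split; [apply/nbhs_ballP; exists d|exists B; split => //; exact: num_real].
  move=> [s M] /= [+ BM] s0 su; rewrite /ball /= ltr_distlC => /andP[sl sr].
  by apply: le_trans (ltW BM); apply: H.
exists (M + 1) => s s0 su; apply: (HM.2 _ _ s) => //=; first by rewrite ltrDl.
by rewrite in_itv /= s0.
Qed.

(** Convertible with [run_sup] at a fixed outcome; stated for a bare path so as to serve X and -X
    alike. *)
Definition path_sup (t : R) : R := sup [set x s | s in `[0, t]].

Lemma path_sup_ub s u : 0 <= s -> s <= u -> x s <= path_sup u.
Proof.
move=> s0 su; have [M HM] := cadlag_bounded u.
apply: ub_le_sup; last by exists s => //=; rewrite in_itv /= s0.
by exists M => _ [r /=] /[!in_itv] /= /andP[r0 ru] <-; exact: HM.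
Qed.

Lemma path_sup_le u a : 0 <= u -> (forall s, 0 <= s -> s <= u -> x s <= a) ->
  path_sup u <= a.
Proof.
move=> u0 H; apply: ge_sup.
  by exists (x 0), 0 => //=; rewrite in_itv /= lexx.
by move=> _ [r /=] /[!in_itv] /= /andP[r0 ru] <-; exact: H.
Qed.

Lemma path_sup_gt u a : 0 <= u -> a < path_sup u ->
  exists s, [/\ 0 <= s, s <= u & a < x s].
Proof.
move=> u0 /sup_gt[|_ [s /=] /[!in_itv] /= /andP[s0 su] <- ?]; last by exists s.
by exists (x 0), 0 => //=; rewrite in_itv /= lexx.
Qed.

Lemma path_sup_mono u v : 0 <= u -> u <= v -> path_sup u <= path_sup v.
Proof.
move=> u0 uv; apply: path_sup_le => // s s0 su.
by apply: path_sup_ub => //; exact: le_trans uv.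
Qed.

End CadlagPaths.

(** * Sampling a path along the grid of mesh 1 / (n + 1) *)

Section Grid.
Context {R : realType}.
Implicit Types (x : R -> R) (u : R).

Definition grid (n k : nat) : R := k%:R / n.+1%:R.

Definition grid_max x n k : R := \big[Num.max/x 0]_(j < k.+1) x (grid n j).

(* The index of the first grid point strictly to the right of [u >= 0]. *)
Definition next_index n u : nat := (Num.truncn (u * n.+1%:R)).+1.

Lemma grid0 n : grid n 0 = 0. Proof. by rewrite /grid mul0r. Qed.

Lemma grid_ge0 n k : 0 <= grid n k. Proof. by rewrite divr_ge0. Qed.

Lemma gridD n j k : grid n (j + k) = grid n j + grid n k.
Proof. by rewrite /grid natrD mulrDl. Qed.

Lemma le_grid n j k : (grid n j <= grid n k) = (j <= k)%N.
Proof. by rewrite /grid ler_pM2r ?invr_gt0 // ler_nat. Qed.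

Lemma lt_grid n j k : (grid n j < grid n k) = (j < k)%N.
Proof. by rewrite /grid ltr_pM2r ?invr_gt0 // ltr_nat. Qed.

Lemma next_index_gt n u : 0 <= u -> u < grid n (next_index n u).
Proof.
move=> u0; rewrite /grid ltr_pdivlMr //.
by have /andP[_] := truncn_itv (mulr_ge0 u0 (ler0n R n.+1)).
Qed.

Lemma next_index_le n u : 0 <= u -> grid n (next_index n u).-1 <= u.
Proof.
move=> u0; rewrite /grid ler_pdivrMr //=.
by have /andP[] := truncn_itv (mulr_ge0 u0 (ler0n R n.+1)).
Qed.

Lemma next_index_def n u k : grid n k <= u -> u < grid n k.+1 -> next_index n u = k.+1.
Proof.
rewrite /grid ler_pdivrMr // ltr_pdivlMr // => l r.
by rewrite /next_index (@truncn_def _ _ k) // l r.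
Qed.

Lemma next_index_le_grid n u : 0 <= u -> grid n (next_index n u) <= u + n.+1%:R^-1.
Proof.
move=> u0; rewrite -[next_index n u]prednK // -addn1 gridD lerD ?next_index_le //.
by rewrite /grid mul1r.
Qed.

Lemma next_index_mono n u v : 0 <= u -> u <= v -> (next_index n u <= next_index n v)%N.
Proof.
move=> u0 uv; rewrite -ltnS -(lt_grid n) -[X in _ < grid _ X]addn1 gridD.
have h1 : grid n 1 = n.+1%:R^-1 by rewrite /grid mul1r.
rewrite -[next_index n u]prednK // -addn1 gridD ltrD2r.
apply: le_lt_trans (next_index_gt n (le_trans u0 uv)).
by apply: le_trans uv; exact: next_index_le.
Qed.

Lemma invSn_near d : 0 < d -> \forall n \near \oo, (n.+1%:R : R)^-1 < d.
Proof.
move=> d0; have := @cvg_harmonic R => /cvgrPdist_lt/(_ d d0).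
by apply: filterS => n; rewrite sub0r normrN ger0_norm ?invr_ge0.
Qed.

Lemma cvg_next_grid u : 0 <= u -> grid n (next_index n u) @[n --> \oo] --> u.
Proof.
move=> u0; apply/cvgrPdist_lt => e e0; near=> n.
have h1 := next_index_gt n u0; have h2 := next_index_le_grid n u0.
have h3 : (n.+1%:R : R)^-1 < e by near: n; exact: invSn_near.
rewrite ltr_distlC; apply/andP; split; first lra.
by apply: le_lt_trans h2 _; rewrite ltrD2l.
Unshelve. all: by end_near. Qed.

Lemma right_continuous_next_grid x u : 0 <= u -> x s @[s --> u^'+] --> x u ->
  x (grid n (next_index n u)) @[n --> \oo] --> x u.
Proof.
move=> u0 /cvg_at_rightP; apply; split; last exact: cvg_next_grid.
by move=> n; exact: next_index_gt.
Qed.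

Lemma grid_max_ub x n k j : (j <= k)%N -> x (grid n j) <= grid_max x n k.
Proof.
by move=> jk; rewrite /grid_max (le_bigmax _ _ (Ordinal (jk : (j < k.+1)%N))).
Qed.

Lemma grid_max_le x n k a : (forall j, (j <= k)%N -> x (grid n j) <= a) ->
  grid_max x n k <= a.
Proof.
by move=> H; apply/bigmax_leP; split=> [|j _]; [rewrite -(grid0 n) H|rewrite H // -ltnS].
Qed.

(** From below, a near-maximizer s is approached from the right by grid points of index at most that
    of [u]. From above, the only grid point that may lie beyond [u] is within one mesh of it, where
    right continuity at [u] keeps the path below x(u) + e/2. *)
Lemma cvg_grid_max x u :
  (forall t, 0 <= t -> x s @[s --> t^'+] --> x t) ->
  (forall t, 0 < t -> cvg (x s @[s --> t^'-])) -> 0 <= u ->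
  grid_max x n (next_index n u) @[n --> \oo] --> path_sup x u.
Proof.
move=> rc ll u0; apply/cvgrPdist_lt => e e0.
have e20 : 0 < e / 2 by rewrite divr_gt0.
have [s [s0 su xs]] : exists s, [/\ 0 <= s, s <= u & path_sup x u - e / 2 < x s].
  by apply: path_sup_gt => //; lra.
have [d d0 Hd] := right_cont_eps rc u0 e20.
have := right_continuous_next_grid s0 (rc s s0) => /cvgrPdist_lt/(_ _ e20) Hs.
near=> n.
rewrite ltr_distlC; apply/andP; split.
  have := grid_max_ub x n (next_index_mono n s0 su).
  have : `|x s - x (grid n (next_index n s))| < e / 2 by near: n.
  by rewrite ltr_distlC; lra.
apply: (@le_lt_trans _ _ (path_sup x u + e / 2)); last lra.
apply: grid_max_le => j jn.
have jg : grid n j <= u + n.+1%:R^-1.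
  by apply: le_trans (next_index_le_grid n u0); rewrite le_grid.
have nd : (n.+1%:R : R)^-1 < d by near: n; exact: invSn_near.
have [ju|ju] := leP (grid n j) u.
  by have := path_sup_ub rc ll (grid_ge0 n j) ju; lra.
have jd : grid n j < u + d by apply: le_lt_trans jg _; rewrite ltrD2l.
have := Hd _ ju jd; rewrite ltr_distlC => /andP[? ?].
by have := path_sup_ub rc ll u0 (lexx u); lra.
Unshelve. all: by end_near. Qed.

End Grid.

(** * Continuous additive set functions *)

Section SignedSetFunctions.
Context d {T : measurableType d} {R : realType}.
Implicit Types (nu : set T -> R).

(** Finite signed measures in a real-valued form, convenient for linear combinations and for
    integration over a time parameter. *)
Definition continuous_additive nu :=
  (forall A B, measurable A -> measurable B -> A `&` B = set0 ->
     nu (A `|` B) = nu A + nu B) /\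
  (forall F : nat -> set T, (forall n, measurable (F n)) -> nondecreasing_seq F ->
     nu (F n) @[n --> \oo] --> nu (\bigcup_n F n)).

(** The measurable sets of agreement form a lambda-system. For signed set functions the total mass
    is not normalized, so agreement on [setT] enters as a separate premise. *)
Lemma continuous_additive_eq (G : set (set T)) nu1 nu2 :
  setI_closed G -> @measurable _ T = <<s G >> ->
  continuous_additive nu1 -> continuous_additive nu2 ->
  nu1 setT = nu2 setT -> (forall A, G A -> nu1 A = nu2 A) ->
  forall A, measurable A -> nu1 A = nu2 A.
Proof.
move=> GI mG [a1 c1] [a2 c2] nuT nuG A; rewrite mG => GA.
suff [] : (measurable `&` [set A | nu1 A = nu2 A]) A by [].
move: A GA; apply: (@lambda_system_subset _ G GI setT) => //; last first.
  by move=> A GA; split; [rewrite mG; exact: sub_sigma_algebra|exact: nuG].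
have diff nu B A : continuous_additive nu -> measurable A -> measurable B -> B `<=` A ->
    nu (A `\` B) = nu A - nu B.
  move=> [a _] mA mB BA; rewrite -{2}(setDUK BA) a //; first by ring.
    exact: measurableD.
  by rewrite setDIK.
split=> //.
- move=> A B BA [mA eA] [mB eB]; split; first exact: measurableD.
  by rewrite /= !diff ?eA ?eB.
- move=> F ndF KF; split; first by apply: bigcupT_measurable => n; have [] := KF n.
  have mF n : measurable (F n) by have [] := KF n.
  rewrite /= -(cvg_lim (@Rhausdorff R) (c1 F mF ndF)).
  rewrite -(cvg_lim (@Rhausdorff R) (c2 F mF ndF)).
  suff -> : (fun n => nu1 (F n)) = (fun n => nu2 (F n)) by [].
  by apply/funext => n; have [] := KF n.
Qed.

Lemma continuous_additive_set0 nu : continuous_additive nu -> nu set0 = 0.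
Proof.
move=> [a _]; have := a set0 set0 measurable0 measurable0 (setI0 _).
by rewrite setU0 => /eqP; rewrite addrC -subr_eq subrr eq_sym => /eqP.
Qed.

Lemma continuous_additive0 : continuous_additive (fun=> 0 : R).
Proof. by split=> [*|*]; [rewrite addr0|exact: cvg_cst]. Qed.

Lemma continuous_additiveD nu1 nu2 : continuous_additive nu1 ->
  continuous_additive nu2 -> continuous_additive (fun A => nu1 A + nu2 A).
Proof.
move=> [a1 c1] [a2 c2]; split=> [A B mA mB AB|F mF ndF].
  by rewrite a1 // a2 // addrACA.
by apply: cvgD; [exact: c1|exact: c2].
Qed.

Lemma continuous_additiveZ (c : R) nu : continuous_additive nu ->
  continuous_additive (fun A => c * nu A).
Proof.
move=> [a1 c1]; split=> [A B mA mB AB|F mF ndF].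
  by rewrite a1 // mulrDr.
by apply: cvgMl_tmp; exact: c1.
Qed.

Lemma continuous_additive_sum (I : Type) (r : seq I) (nu : I -> set T -> R) :
  (forall i, continuous_additive (nu i)) ->
  continuous_additive (fun A => \sum_(i <- r) nu i A).
Proof.
move=> H; elim: r => [|i r IH].
  rewrite (_ : (fun A => _) = (fun=> 0)) //; first exact: continuous_additive0.
  by apply/funext => A; rewrite big_nil.
rewrite (_ : (fun A => _) = (fun A => nu i A + \sum_(i <- r) nu i A)).
  exact: continuous_additiveD.
by apply/funext => A; rewrite big_cons.
Qed.

(** Partial sums over disjoint sets are values on the increasing partial unions, where continuity
    from below applies. *)
Lemma continuous_additive_sigma nu : continuous_additive nu ->
  semi_sigma_additive (fun A => (nu A)%:E).
Proof.
move=> ca; have [a c] := ca; move=> F mF tF mUF.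
have mU n : measurable (\big[setU/set0]_(i < n) F i).
  by apply: bigsetU_measurable => i _.
have sE n : (\sum_(0 <= i < n) (nu (F i))%:E)%E = (nu (\big[setU/set0]_(i < n) F i))%:E.
  elim: n => [|n IH]; first by rewrite big_geq // big_ord0 continuous_additive_set0.
  rewrite big_nat_recr //= IH big_ord_recr /= a ?EFinD //.
    exact: mU.
  apply/seteqP; split=> // t [+ Ft]; rewrite -bigcup_mkord => -[i /= ilt Fit].
  by move: ilt; rewrite (tF i n I I) ?ltnn //; exists t.
under eq_cvg do rewrite sE.
have nd : nondecreasing_seq (fun n => \big[setU/set0]_(i < n) F i).
  move=> m n mn; apply/subsetPset => t; rewrite -!bigcup_mkord => -[i /= im Fi].
  by exists i => //=; exact: leq_trans mn.
have UE : \bigcup_n \big[setU/set0]_(i < n) F i = \bigcup_n F n.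
  apply/seteqP; split=> t [n _].
    by rewrite -bigcup_mkord => -[i /= _ Fi]; exists i.
  by move=> Fn; exists n.+1 => //; rewrite -bigcup_mkord; exists n => /=.
have := c _ mU nd; rewrite UE => H.
by apply: cvg_EFin; [exact: nearW|exact: H].
Qed.

Lemma continuous_additive_charge nu : continuous_additive nu ->
  exists mu : {charge set T -> \bar R}, forall A, mu A = (nu A)%:E.
Proof.
move=> ca; pose m := fun A => (nu A)%:E.
have m0 : m set0 = 0%E by rewrite /m continuous_additive_set0.
have mf A : measurable A -> m A \is a fin_num by [].
pose B := isCharge.Build _ _ _ m m0 mf (continuous_additive_sigma ca).
pose mu : {charge set T -> \bar R} := HB.pack m B.
by exists mu.
Qed.

(** The event [E] allows a joint law to be seen as a function of one set while the constraint on the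
    other variable is frozen. *)
Lemma continuous_additive_prob (d' : measure_display) (Omega : measurableType d')
    (P : probability Omega R) (E : set Omega) (f : Omega -> T) :
  measurable E -> measurable_fun setT f ->
  continuous_additive (fun A => fine (P (E `&` f @^-1` A))).
Proof.
move=> mE mf.
have mEf A : measurable A -> measurable (E `&` f @^-1` A).
  by move=> mA; apply: measurableI => //; rewrite -[X in measurable X]setTI; exact: mf.
split=> [A B mA mB AB|F mF ndF].
  rewrite preimage_setU setIUr measureU ?fineD ?fin_num_measure //; try exact: mEf.
  apply/seteqP; split=> // w [[_ aw] [_ bw]].
  by have : (A `&` B) (f w) by []; rewrite AB.
apply: fine_cvg; rewrite fineK; last first.
  by apply: fin_num_measure; apply: mEf; exact: bigcupT_measurable.
rewrite preimage_bigcup setI_bigcupr.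
apply: (@nondecreasing_cvg_mu _ _ _ P (fun n => E `&` f @^-1` F n)).
- by move=> n; exact: mEf.
- by apply: bigcupT_measurable => n; exact: mEf.
- move=> m n mn; apply/subsetPset; apply: setIS; apply: preimage_subset.
  by apply/subsetPset; exact: ndF.
Qed.

End SignedSetFunctions.

(** * Half-lines with admissible end points as a generating class *)

Section HalfLines.
Context {R : realType}.
Implicit Types (a b c : R).

Lemma countable_avoid (Ex : set R) a b : countable Ex -> a < b ->
  exists c, [/\ a < c, c < b & ~ Ex c].
Proof.
move=> cE ab; apply: contrapT => H.
have : (lebesgue_measure (`]a, b[%classic : set R) = 0)%E.
  apply: countable_lebesgue_measure0; apply: sub_countable cE.
  apply: subset_card_le => c /=; rewrite in_itv /= => /andP[ac cb].
  by apply: contrapT => nE; apply: H; exists c.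
rewrite lebesgue_measure_itv /= lte_fin ab => /eqP.
by rewrite -EFinB eqe subr_eq0 gt_eqF.
Qed.

Definition half_lines (Ex : set R) : set (set R) :=
  [set `]a, +oo[%classic | a in ~` Ex].

Lemma half_linesI Ex : setI_closed (half_lines Ex).
Proof.
move=> _ _ [a Ea <-] [b Eb <-]; exists (Num.max a b).
  by rewrite /= /Num.max; case: ifP.
apply/seteqP; split=> c /=; rewrite !in_itv /= !andbT gt_max => /andP //.
Qed.

(** An open half-line at a forbidden level a is the union of half-lines at admissible levels in ]a,
    a + 1/(n+1)[, which exist because an interval is not countable. *)
Lemma half_lines_generate Ex : countable Ex ->
  @measurable _ R = <<s half_lines Ex >>.
Proof.
move=> cE; rewrite -[LHS]/((@ocitv R).-sigma.-measurable) RGenOInfty.measurableE.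
apply/seteqP; split => A; last first.
  apply: smallest_sub; first exact: smallest_sigma_algebra.
  by move=> _ [a _ <-]; apply: sub_sigma_algebra; exists a.
apply: smallest_sub; first exact: smallest_sigma_algebra.
move=> _ [a ->].
have pick n : {c | [/\ a < c, c < a + n.+1%:R^-1 & ~ Ex c]}.
  by apply: cid; apply: countable_avoid => //; rewrite ltrDl invr_gt0.
have -> : `]a, +oo[%classic = \bigcup_n `](projT1 (pick n)), +oo[%classic.
  apply/seteqP; split=> x /=; last first.
    move=> [n _] /=; rewrite !in_itv /= !andbT; apply: lt_trans.
    by case: (pick n) => c [].
  rewrite in_itv /= andbT => ax.
  have xa : 0 < x - a by rewrite subr_gt0.
  have [N _ /(_ N (leqnn N)) /= HN] : \forall n \near \oo, (n.+1%:R : R)^-1 < x - a.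
    have := @cvg_harmonic R => /cvgrPdist_lt/(_ _ xa).
    by apply: filterS => n; rewrite sub0r normrN ger0_norm ?invr_ge0.
  exists N => //=; rewrite in_itv /= andbT.
  case: (pick N) => c [_ cN _] /=; apply: lt_trans cN _.
  by rewrite addrC -ltrBrDr.
have [_ _] := smallest_sigma_algebra setT (half_lines Ex); apply => n.
by apply: sub_sigma_algebra; exists (projT1 (pick n)) => //; case: (pick n) => c [].
Qed.

Lemma measurable_itvoy a : measurable (`]a, +oo[%classic : set R).
Proof. exact: measurable_itv. Qed.

(** Lets the total mass be recovered as a limit over admissible half-lines, so that agreement on
    those already includes agreement on the whole line. *)
Lemma exhausting_half_lines (Ex : set R) : countable Ex ->
  exists c : nat -> R, [/\ forall n, ~ Ex (c n),
    nondecreasing_seq (fun n => `](c n), +oo[%classic : set R) &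
    \bigcup_n `](c n), +oo[%classic = [set: R]].
Proof.
move=> cE.
have /choice[c cP] : forall n : nat, exists c, [/\ - n.+1%:R < c, c < - n%:R & ~ Ex c].
  by move=> n; apply: countable_avoid => //; rewrite ltrN2 ltr_nat.
exists c; split.
- by move=> n; case: (cP n).
- apply/nondecreasing_seqP => n; apply/subsetPset => x /=; rewrite !in_itv /= !andbT.
  have [lc _ _] := cP n; have [_ rc' _] := cP n.+1.
  by apply: lt_trans; exact: lt_trans lc.
- apply/seteqP; split=> // x _; exists (Num.truncn `|x|).+1 => //=.
  rewrite in_itv /= andbT; have [_ rc _] := cP (Num.truncn `|x|).+1.
  apply: lt_trans rc _.
  rewrite ltrNl; apply: le_lt_trans (ler_norm _) _; rewrite normrN.
  exact: truncnS_gt.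
Qed.

Lemma continuous_additive_eq_half_lines (Ex : set R) (nu1 nu2 : set R -> R) :
  countable Ex -> continuous_additive nu1 -> continuous_additive nu2 ->
  (forall a, ~ Ex a -> nu1 `]a, +oo[%classic = nu2 `]a, +oo[%classic) ->
  forall A, measurable A -> nu1 A = nu2 A.
Proof.
move=> cE ca1 ca2 H; apply: (continuous_additive_eq (@half_linesI Ex)) => //.
- exact: half_lines_generate.
- have [c [cE' nd cT]] := exhausting_half_lines cE; rewrite -cT.
  have m n := measurable_itvoy (c n).
  rewrite -(cvg_lim (@Rhausdorff R) (ca1.2 _ m nd)).
  rewrite -(cvg_lim (@Rhausdorff R) (ca2.2 _ m nd)).
  suff -> : (fun n => nu1 `](c n), +oo[%classic) =
    (fun n => nu2 `](c n), +oo[%classic) by [].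
  by apply/funext => n; exact: H.
- by move=> _ [a Ea <-]; exact: H.
Qed.

(** Among disjoint events at most n have probability above 1 / (n + 1), since n + 1 of them would
    sum to more than 1. This serves both for atoms of a law and for exceptional times of a running
    supremum. *)
Lemma countable_pos_prob d (Omega : measurableType d) (P : probability Omega R)
    (E : R -> set Omega) : (forall i, measurable (E i)) -> trivIset setT E ->
  countable [set i | P (E i) != 0%E].
Proof.
move=> mE tE.
rewrite [X in countable X](_ : _ =
    \bigcup_n [set r | n.+1%:R^-1 < fine (P (E r))]); last first.
  have PE r : P (E r) = (fine (P (E r)))%:E by rewrite fineK // fin_num_measure.
  apply/seteqP; split=> [r /= Er|r [k _ /= kr]].
    have : 0 < fine (P (E r)).
      by rewrite -lte_fin -PE lt0e Er /=.
    by move=> /ltr_add_invr[k]; rewrite add0r; exists k.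
  by rewrite PE eqe gt_eqF // (lt_trans _ kr) // invr_gt0.
apply: bigcup_countable => // n _; apply: finite_set_countable.
apply: contrapT => /infiniteP/pcard_leP/injfunPex[/= q q_fun q_inj].
have mU : measurable (\bigcup_k E (q k)) by exact: bigcupT_measurable.
have := probability_le1 P mU; rewrite leNgt => /negP; apply.
have -> : P (\bigcup_k E (q k)) = (\sum_(0 <= k <oo) P (E (q k)))%E.
  rewrite measure_bigcup //; first by apply: eq_eseriesl => // i; rewrite in_setT.
  by move=> i j _ _ /(tE _ _ I I)/q_inj; apply; rewrite inE.
apply: (lt_le_trans _ (nneseries_lim_ge n.+1 _)) => //.
rewrite -EFin_sum_fine //; last by move=> ? _; rewrite fin_num_measure.
rewrite lte_fin (_ : 1 = \sum_(0 <= k < n.+1) (n.+1%:R^-1 : R)); last first.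
  by rewrite sumr_const_nat subn0 -[RHS]mulr_natr mulVf.
by apply: ltr_sum => // k _; exact: q_fun.
Qed.

End HalfLines.

(** * Increments along a grid *)

Section MeasurabilityHelpers.
Context d {T : measurableType d} {R : realType}.
Implicit Types f g : T -> R.

Lemma measurable_set_le f g : measurable_fun setT f -> measurable_fun setT g ->
  measurable [set x | f x <= g x].
Proof.
by move=> mf mg; rewrite -[X in measurable X]setTI; apply: measurable_fun_le.
Qed.

Lemma measurable_set_lt f g : measurable_fun setT f -> measurable_fun setT g ->
  measurable [set x | f x < g x].
Proof.
move=> mf mg; rewrite (_ : [set x | _] = ~` [set x | g x <= f x]).
  by apply: measurableC; exact: measurable_set_le.
by apply/seteqP; split=> x /=; rewrite ltNge => /negP.
Qed.

Lemma measurable_set_pre f (A : set R) : measurable_fun setT f -> measurable A ->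
  measurable [set x | A (f x)].
Proof.
by move=> mf mA; rewrite -[X in measurable X]setTI; exact: mf.
Qed.

Lemma measurable_set_forall (k : nat) (Q : nat -> set T) :
  (forall j, (j < k)%N -> measurable (Q j)) ->
  measurable [set x | forall j, (j < k)%N -> Q j x].
Proof.
move=> mQ; rewrite (_ : [set x | _] = \bigcap_(j < k) Q j).
  by apply: fin_bigcap_measurable => //; exact: finite_II.
by apply/seteqP; split=> x H j; exact: H.
Qed.

Lemma measurable_bigmax (I : Type) (s : seq I) (z : T -> R) (f : I -> T -> R) :
  measurable_fun setT z -> (forall i, measurable_fun setT (f i)) ->
  measurable_fun setT (fun x => \big[Num.max/z x]_(i <- s) f i x).
Proof.
move=> mz mf; elim: s => [|i s IH].
  by under eq_fun do rewrite big_nil.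
by under eq_fun do rewrite big_cons; exact: measurable_maxr.
Qed.

End MeasurabilityHelpers.

Section TupleCylinders.
Context {R : realType} (m : nat).

Definition tuple_cylinders : set (set (m.-tuple R)) :=
  [set A | exists2 C : 'I_m -> set R, (forall i, measurable (C i)) &
    A = [set x | forall i, C i (tnth x i)]].

Lemma tuple_cylindersI : setI_closed tuple_cylinders.
Proof.
move=> _ _ [C mC ->] [C' mC' ->]; exists (fun i => C i `&` C' i).
  by move=> i; exact: measurableI.
apply/seteqP; split=> x /=; first by move=> [H H'] i; split.
by move=> H; split=> i; have [] := H i.
Qed.

Lemma tuple_cylinders_generate : @measurable _ (m.-tuple R) = <<s tuple_cylinders >>.
Proof.
apply/seteqP; split.
  apply: smallest_sub; first exact: smallest_sigma_algebra.
  rewrite -bigcup_seq; apply: bigcup_sub => i _ _ [B mB <-].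
  apply: sub_sigma_algebra; exists (fun j => if j == i then B else setT).
    by move=> j; case: ifP.
  apply/seteqP; split=> x /=; first by case=> _ Bx j; case: eqP => // ->.
  by move=> /(_ i); rewrite eqxx.
apply: smallest_sub; first exact: sigma_algebra_measurable.
move=> _ [C mC ->].
rewrite (_ : [set x | _] = \bigcap_(i in [set: 'I_m]) [set x | C i (tnth x i)]).
  apply: fin_bigcap_measurable => // i _.
  by apply: measurable_set_pre => //; exact: measurable_tnth.
by apply/seteqP; split=> x H i; [move=> _|]; exact: H.
Qed.

Definition tuple_psum (x : m.-tuple R) (j : nat) : R :=
  \sum_(i < m | (i < j)%N) tnth x i.

Lemma measurable_tuple_psum j : measurable_fun setT (tuple_psum ^~ j).
Proof.
rewrite (_ : tuple_psum ^~ j = fun x =>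
  \sum_(i <- [seq i : 'I_m <- index_enum 'I_m | (i < j)%N]) tnth x i).
  by apply: measurable_sum => i; exact: measurable_tnth.
by apply/funext => x; rewrite big_filter.
Qed.

End TupleCylinders.

Section GridIncrements.
Context {d : measure_display} {Omega : measurableType d} {R : realType}.
Context {P : probability Omega R} {X : R -> Omega -> R}.
Hypothesis X_levy : levy_process P X.
Variable n : nat.

Let pr (E : set Omega) : R := fine (P E).
Let S k w : R := X (grid n k) w.
Let xi k w : R := S k.+1 w - S k w.
Let sig (s : R) := \bigcup_(t in `[0, s]) preimage_set_system setT (X t) measurable.

Lemma measurable_past (I : set R) t : I t ->
  measurable_fun setT (X t : g_sigma_algebraType
    (\bigcup_(t in I) preimage_set_system setT (X t) measurable) -> R).
Proof.
by move=> It _ B mB; apply: sub_sigma_algebra; exists t => //; exists B.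
Qed.

Lemma measurable_grid_past k j : (j <= k)%N ->
  measurable_fun setT (S j : g_sigma_algebraType (sig (grid n k)) -> R).
Proof.
move=> jk; apply: measurable_past.
by rewrite /= in_itv /= grid_ge0 le_grid.
Qed.

Lemma measurable_grid k : measurable_fun setT (S k).
Proof. by apply: (levy_measurable X_levy); exact: grid_ge0. Qed.

Lemma sigma_process_mono s s' : s <= s' ->
  sigma_process X `[0, s] `<=` sigma_process X `[0, s'].
Proof.
move=> ss'; apply: sub_sigma_algebra2 => A [t /= ts At]; exists t => //.
by move: ts; rewrite /= !in_itv /= => /andP[-> /le_trans ->].
Qed.

Lemma sigma_process_measurable s E : sigma_process X `[0, s] E -> measurable E.
Proof.
apply: smallest_sub; first exact: sigma_algebra_measurable.
move=> A [t /=]; rewrite in_itv /= => /andP[t0 _] [B mB <-].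
exact: (levy_measurable X_levy t0).
Qed.

Lemma prM E H : measurable E -> measurable H -> P (E `&` H) = (P E * P H)%E ->
  pr (E `&` H) = pr E * pr H.
Proof. by move=> mE mH EH; rewrite /pr EH fineM // fin_num_measure. Qed.

(** A past event at index k, intersected with conditions on the next m increments, is a past event
    at index k + m; independence of one further increment can thus be iterated. Stationarity gives
    each factor the law of the first increment. *)
Lemma increments_product k m (C : nat -> set R) E :
  (forall i, measurable (C i)) -> sigma_process X `[0, grid n k] E ->
  pr (E `&` [set w | forall i, (i < m)%N -> C i (xi (k + i) w)]) =
  pr E * \prod_(i < m) pr (X (grid n 1) @^-1` C i).
Proof.
move=> mC sE; elim: m => [|m IH].
  rewrite big_ord0 mulr1; congr pr; apply/seteqP; split=> [w []//|w Ew].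
  by split.
pose F := E `&` [set w | forall i, (i < m)%N -> C i (xi (k + i) w)].
have sF : sigma_process X `[0, grid n (k + m)] F.
  rewrite -[sigma_process _ _]/(@measurable _ (g_sigma_algebraType (sig (grid n (k + m))))).
  apply: measurableI.
    by apply: sigma_process_mono sE; rewrite le_grid leq_addr.
  apply: measurable_set_forall => j jm; apply: measurable_set_pre => //.
  by apply: measurable_funB; apply: measurable_grid_past; rewrite -?addnS leq_add2l // ltnW.
rewrite big_ord_recr mulrA /= -IH -/F.
have -> : E `&` [set w | forall i, (i < m.+1)%N -> C i (xi (k + i) w)] =
    F `&` (X (grid n (k + m).+1) \- X (grid n (k + m))) @^-1` C m.
  apply/seteqP; split=> w /=.
    by move=> [Ew H]; split; [split=> // i im; apply: H; exact: ltnW|exact: H].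
  move=> [[Ew H] Hm]; split=> // i; rewrite ltnS leq_eqVlt => /orP[/eqP ->//|].
  exact: H.
have mI : measurable ((X (grid n (k + m).+1) \- X (grid n (k + m))) @^-1` C m).
  apply: (@measurable_set_pre _ _ _ (X (grid n (k + m).+1) \- X (grid n (k + m)))) => //.
  by apply: measurable_funB; exact: measurable_grid.
rewrite prM //; last 2 first.
- exact: sigma_process_measurable sF.
- have le1 : grid n (k + m) <= grid n (k + m).+1 :> R by rewrite le_grid.
  apply: (levy_indep_incr X_levy (grid_ge0 n (k + m)) le1 sF).
  by exists (C m) => //; rewrite setTI.
congr (_ * _); rewrite /pr (levy_stat_incr X_levy) ?grid_ge0 ?le_grid //.
by rewrite -addn1 gridD addrC addKr.
Qed.

Definition increments k m (w : Omega) : m.-tuple R := [tuple xi (k + i) w | i < m].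

Definition rev_increments m (w : Omega) : m.-tuple R := [tuple xi (rev_ord i) w | i < m].

Lemma measurable_increments k m : measurable_fun setT (increments k m).
Proof.
apply/measurable_fun_tnthP => i; rewrite /comp; under eq_fun do rewrite tnth_mktuple.
by apply: measurable_funB; exact: measurable_grid.
Qed.

Lemma measurable_rev_increments m : measurable_fun setT (rev_increments m).
Proof.
apply/measurable_fun_tnthP => i; rewrite /comp; under eq_fun do rewrite tnth_mktuple.
by apply: measurable_funB; exact: measurable_grid.
Qed.

Lemma increments_cylinder k m (C : 'I_m -> set R) E :
  (forall i, measurable (C i)) -> sigma_process X `[0, grid n k] E ->
  pr (E `&` increments k m @^-1` [set x | forall i, C i (tnth x i)]) =
  pr E * \prod_(i < m) pr (X (grid n 1) @^-1` C i).
Proof.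
move=> mC sE.
pose C' i := if insub i is Some j then C j else setT.
have C'E (i : 'I_m) : C' i = C i by rewrite /C' valK.
have mC' i : measurable (C' i) by rewrite /C'; case: insub.
under eq_bigr do rewrite -C'E.
rewrite -(increments_product m mC' sE); congr pr; congr (_ `&` _); apply/seteqP.
split=> w /= H i; last first.
  by rewrite tnth_mktuple -C'E; exact: H.
by move=> im; have := H (Ordinal im); rewrite tnth_mktuple -C'E.
Qed.

Lemma past_setT : sigma_process X `[0, grid n 0] setT.
Proof.
exact: (@measurableT _ (g_sigma_algebraType (sig (grid n 0)))).
Qed.

Lemma pr_setT : pr setT = 1. Proof. by rewrite /pr probability_setT. Qed.

(** Both sides are finite measures in [D], so the product formula on cylinders decides. *)
Lemma increments_markov k m E D : sigma_process X `[0, grid n k] E ->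
  measurable D ->
  pr (E `&` increments k m @^-1` D) = pr E * pr (increments 0 m @^-1` D).
Proof.
move=> sE; rewrite -[increments 0 m @^-1` _]setTI.
move: D; apply: (continuous_additive_eq (@tuple_cylindersI R m)).
- exact: tuple_cylinders_generate.
- apply: continuous_additive_prob; last exact: measurable_increments.
  exact: sigma_process_measurable sE.
- apply: continuous_additiveZ; apply: continuous_additive_prob => //.
  exact: measurable_increments.
- by rewrite !preimage_setT !setIT pr_setT mulr1.
- move=> _ [C mC ->]; rewrite !increments_cylinder //; last exact: past_setT.
  by rewrite pr_setT mul1r.
Qed.

(** The product formula on cylinders has identical factors and is invariant under a permutation of
    the coordinates. *)
Lemma increments_reverse m D : measurable D ->
  pr (increments 0 m @^-1` D) = pr (rev_increments m @^-1` D).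
Proof.
rewrite -[increments 0 m @^-1` _]setTI -[rev_increments m @^-1` _]setTI.
move: D; apply: (continuous_additive_eq (@tuple_cylindersI R m)).
- exact: tuple_cylinders_generate.
- by apply: continuous_additive_prob => //; exact: measurable_increments.
- by apply: continuous_additive_prob => //; exact: measurable_rev_increments.
- by rewrite !preimage_setT.
- move=> _ [C mC ->].
  have -> : rev_increments m @^-1` [set x | forall i, C i (tnth x i)] =
      increments 0 m @^-1` [set x | forall i, C (rev_ord i) (tnth x i)].
    apply/seteqP; split=> w /= H i; have := H (rev_ord i);
      by rewrite !tnth_mktuple ?rev_ordK.
  rewrite (@increments_cylinder 0 m C) //; last exact: past_setT.
  rewrite (@increments_cylinder 0 m (fun i => C (rev_ord i))) //; last exact: past_setT.
  by congr (_ * _); rewrite (reindex_inj rev_ord_inj).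
Qed.

Lemma increments_psum k m w j : (j <= m)%N ->
  tuple_psum (increments k m w) j = S (k + j) w - S k w.
Proof.
move=> jm; rewrite /tuple_psum; under eq_bigr do rewrite tnth_mktuple.
rewrite -(big_ord_widen m (fun i => xi (k + i) w) jm).
elim: j {jm} => [|j IH]; first by rewrite big_ord0 addn0 subrr.
by rewrite big_ord_recr IH /= /xi addnS; ring.
Qed.

Lemma rev_increments_psum m w j : (j <= m)%N ->
  tuple_psum (rev_increments m w) j = S m w - S (m - j) w.
Proof.
move=> jm; rewrite /tuple_psum; under eq_bigr do rewrite tnth_mktuple.
rewrite -(big_ord_widen m (fun i => xi (m - i.+1) w) jm).
elim: j jm => [|j IH] jm; first by rewrite big_ord0 subn0 subrr.
rewrite big_ord_recr IH /=; last exact: ltnW.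
by rewrite /xi -subSn // subSS; ring.
Qed.

End GridIncrements.

Arguments increments {d Omega R} X n k m w.
Arguments rev_increments {d Omega R} X n m w.

(** * Convolution of sequences *)

Section Convolutions.
Context {R : realFieldType}.
Implicit Types (a b F G H q : nat -> R).

Definition conv a b m := \sum_(j < m.+1) a j * b (m - j)%N.

(** Truncation at degree N does not affect coefficients below N, so convolutions inherit
    commutativity and associativity from polynomials. *)
Lemma conv_poly a b N m : (m < N)%N ->
  ((\poly_(i < N) a i) * (\poly_(i < N) b i))`_m = conv a b m.
Proof.
move=> mN; rewrite coefM; apply: eq_bigr => j _; rewrite !coef_poly.
have jm : (j <= m)%N by rewrite -ltnS.
by rewrite (leq_ltn_trans jm mN) (leq_ltn_trans (leq_subr _ _) mN).
Qed.

(* Both sides are a coefficient of the product of the four polynomials. *)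
Lemma conv_swap a b a1 b1 m : (forall k, conv a1 b1 k = 1) ->
  \sum_(k < m.+1) conv a b k = conv (conv a b1) (conv a1 b) m.
Proof.
move=> one; pose p (c : nat -> R) := \poly_(i < m.+1) c i.
have pc c c' i : (i <= m)%N -> (p c * p c')`_i = conv c c' i.
  by move=> im; exact: conv_poly.
transitivity (((p a * p b1) * (p a1 * p b))`_m).
  rewrite (_ : _ * _ = (p a * p b) * (p a1 * p b1)); last by ring.
  rewrite coefM; apply: eq_bigr => k _.
  have km : (k <= m)%N by exact: (ltn_ord k).
  by rewrite !pc ?leq_subr // one mulr1.
rewrite coefM; apply: eq_bigr => j _.
have jm : (j <= m)%N by exact: (ltn_ord j).
by rewrite !pc ?leq_subr.
Qed.

Lemma summation_by_parts F q N :
  \sum_(n < N) (q n - q n.+1) * (\sum_(m < n.+1) F m) =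
  \sum_(m < N) q m * F m - q N * \sum_(m < N) F m.
Proof.
elim: N => [|N IH]; first by rewrite !big_ord0; ring.
rewrite 3!big_ord_recr /= IH; ring.
Qed.

Lemma triangle_sum (f : nat -> nat -> R) N :
  \sum_(n < N) \sum_(j < n.+1) f j (n - j)%N =
  \sum_(j < N) \sum_(k < N | (j + k < N)%N) f j k.
Proof.
elim: N => [|N IH]; first by rewrite !big_ord0.
rewrite big_ord_recr /= IH [RHS]big_ord_recr /=.
have -> : \sum_(k < N.+1 | (N + k < N.+1)%N) f N k = f N 0.
  rewrite (bigD1 ord0) /= ?addn0 // big1 ?addr0 // => k /andP[Nk k0].
  by case/eqP: k0; apply/val_inj => /=; lia.
rewrite [X in _ + X = _]big_ord_recr /= subnn addrA; congr (_ + _).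
rewrite -big_split /=; apply: eq_bigr => j _.
have jN : (j <= N)%N by exact: ltnW.
rewrite [RHS](bigD1 (inord (N - j))) /=; last first.
  by rewrite inordK ?ltnS ?leq_subr // subnKC.
rewrite inordK ?ltnS ?leq_subr // addrC; congr (_ + _).
rewrite (big_ord_widen_cond N.+1 (fun k => (j + k < N)%N) (f j)) //.
by apply: eq_bigl => k; rewrite -val_eqE /= inordK ?ltnS ?leq_subr //; lia.
Qed.

(** On the triangle j + k < N the double sum is exact: regrouped by n = j + k it becomes a summation
    by parts. The rest of the square has at most N^2 terms of size 2 eps, and the boundary term q_N
    (F_0 + ... + F_(N-1)) is at most N eps <= N^2 eps; hence the constant 3. *)
Lemma discrete_factorization F G H q N (eps : R) :
  (forall n, 0 <= F n <= 1) -> (forall n, 0 <= G n <= 1) -> (forall n, 0 <= H n <= 1) ->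
  (forall m, \sum_(k < m.+1) F k = conv G H m) ->
  (forall n, (N <= n)%N -> `|q n| <= eps) ->
  `|\sum_(j < N) \sum_(k < N) G j * H k * (q (j + k)%N - q (j + k).+1)
    - \sum_(m < N) q m * F m| <= 3 * (N * N)%:R * eps.
Proof.
move=> F01 G01 H01 FGH qe; set e := fun n => q n - q n.+1.
case: N qe => [|N] qe.
  by rewrite !big_ord0 subrr normr0 mulr0 mul0r.
set M := N.+1 in qe *.
have eps0 : 0 <= eps by apply: le_trans (qe M (leqnn _)).
have low : \sum_(j < M) \sum_(k < M | (j + k < M)%N) G j * H k * e (j + k)%N =
    \sum_(m < M) q m * F m - q M * \sum_(m < M) F m.
  rewrite -(triangle_sum (fun j k => G j * H k * e (j + k)%N)).
  rewrite -summation_by_parts; apply: eq_bigr => n _.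
  rewrite FGH mulr_sumr; apply: eq_bigr => j _.
  have jn : (j <= n)%N by exact: (ltn_ord j).
  by rewrite subnKC // mulrC.
have -> : \sum_(j < M) \sum_(k < M) G j * H k * e (j + k)%N =
  \sum_(j < M) \sum_(k < M | (j + k < M)%N) G j * H k * e (j + k)%N +
  \sum_(j < M) \sum_(k < M | ~~ (j + k < M)%N) G j * H k * e (j + k)%N.
  by rewrite -big_split; apply: eq_bigr => j _; exact: bigID.
rewrite low [X in `|X|](_ : _ = \sum_(j < M) \sum_(k < M | ~~ (j + k < M)%N)
  G j * H k * e (j + k)%N - q M * \sum_(m < M) F m); last by ring.
apply: (le_trans (ler_normB _ _)).
have b1 : `|\sum_(j < M) \sum_(k < M | ~~ (j + k < M)%N) G j * H k * e (j + k)%N|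
    <= 2 * (M * M)%:R * eps.
  apply: (le_trans (ler_norm_sum _ _ _)).
  apply: (@le_trans _ _ (\sum_(j < M) \sum_(k < M) 2 * eps)); last first.
    rewrite !sumr_const card_ord -mulrnA -mulr_natr; lra.
  apply: ler_sum => j _; apply: (le_trans (ler_norm_sum _ _ _)).
  rewrite big_mkcond; apply: ler_sum => k _; case: ifP => [|_]; last first.
    by rewrite mulr_ge0.
  rewrite -leqNgt => Mjk; rewrite !normrM.
  have /andP[G0 G1] := G01 j; have /andP[H0 H1] := H01 k.
  rewrite (ger0_norm G0) (ger0_norm H0).
  rewrite -[leRHS]mul1r ler_pM ?mulr_ge0 //; first by rewrite mulr_ile1.
  apply: (le_trans (ler_normB _ _)).
  by rewrite mulr_natl mulr2n lerD ?qe // (leq_trans Mjk).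
have b2 : `|q M * \sum_(m < M) F m| <= (M * M)%:R * eps.
  rewrite normrM mulrC ler_pM ?qe //.
  have F0 : 0 <= \sum_(m < M) F m by apply: sumr_ge0 => m _; case/andP: (F01 m).
  rewrite (ger0_norm F0); apply: (@le_trans _ _ (\sum_(m < M) 1)).
    by apply: ler_sum => m _; case/andP: (F01 m).
  by rewrite sumr_const card_ord ler_nat leq_pmulr.
apply: le_trans (lerD b1 b2) _.
by rewrite [leRHS](_ : _ = 2 * (M * M)%:R * eps + (M * M)%:R * eps) //; ring.
Qed.

End Convolutions.

(** * Factorization along a grid *)

Section GridFactorization.
Context {d : measure_display} {Omega : measurableType d} {R : realType}.
Context {P : probability Omega R} {X : R -> Omega -> R}.
Hypothesis X_levy : levy_process P X.
Variable n : nat.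

Let pr (E : set Omega) : R := fine (P E).
Let S k w : R := X (grid n k) w.
Let sig (s : R) := \bigcup_(t in `[0, s]) preimage_set_system setT (X t) measurable.

Definition grid_sup k w : R := grid_max (X^~ w) n k.

Definition grid_neg_inf k w : R := grid_max (fun s => - X s w) n k.

Definition sup_event k (A B : set R) : set Omega :=
  [set w | A (grid_sup k w) /\ B (grid_sup k w - S k w)].

Definition inf_event k (A B : set R) : set Omega :=
  [set w | A (S k w + grid_neg_inf k w) /\ B (grid_neg_inf k w)].

(** The strict inequality here and the weak one in [descent_event] single out the first index of the
    maximum, which keeps the pieces of the splitting disjoint. *)
Definition record_event k (A : set R) : set Omega :=
  [set w | (forall j, (j < k)%N -> S j w < S k w) /\ A (S k w)].

Definition descent_event k m (B : set R) : set Omega :=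
  [set w | (forall j, (j < m.+1)%N -> S (k + j) w - S k w <= 0) /\
           B (- (S (k + m) w - S k w))].

Lemma measurable_grid_sup k : measurable_fun setT (grid_sup k).
Proof.
apply: measurable_bigmax; first by apply: (levy_measurable X_levy).
by move=> j; exact: (measurable_grid X_levy).
Qed.

Lemma measurable_grid_neg_inf k : measurable_fun setT (grid_neg_inf k).
Proof.
apply: measurable_bigmax.
  by apply: measurableT_comp => //; apply: (levy_measurable X_levy).
by move=> j; apply: measurableT_comp => //; exact: (measurable_grid X_levy).
Qed.

Lemma measurable_sup_event k A B : measurable A -> measurable B ->
  measurable (sup_event k A B).
Proof.
move=> mA mB; apply: measurableI; apply: measurable_set_pre => //.
  exact: measurable_grid_sup.
by apply: measurable_funB; [exact: measurable_grid_sup|exact: (measurable_grid X_levy)].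
Qed.

Lemma record_event_past k A : measurable A ->
  sigma_process X `[0, grid n k] (record_event k A).
Proof.
move=> mA.
rewrite -[sigma_process _ _]/(@measurable _ (g_sigma_algebraType (sig (grid n k)))).
apply: measurableI.
  apply: measurable_set_forall => j jk.
  by apply: measurable_set_lt; apply: measurable_grid_past => //; exact: ltnW.
by apply: measurable_set_pre => //; exact: measurable_grid_past.
Qed.

(** Exhibits the descent as an event on the increments after index k only, the form to which
    [increments_markov] applies. *)
Lemma descent_eventE k m B : descent_event k m B = increments X n k m @^-1`
  ([set x : m.-tuple R | forall j, (j < m.+1)%N -> tuple_psum x j <= 0] `&`
   [set x | B (- tuple_psum x m)]).
Proof.
apply/seteqP; split=> w [H HB]; split.
- by move=> j jm; rewrite increments_psum //; exact: H.
- by rewrite /= increments_psum.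
- by move=> j jm; rewrite -(@increments_psum _ _ _ X n k m) //; exact: H.
- by move: HB; rewrite /= increments_psum.
Qed.

Lemma record_descent_indep k m A B : measurable A -> measurable B ->
  pr (record_event k A `&` descent_event k m B) =
  pr (record_event k A) * pr (descent_event 0 m B).
Proof.
move=> mA mB; rewrite !descent_eventE /pr (increments_markov X_levy) //.
  exact: record_event_past.
apply: measurableI.
  apply: measurable_set_forall => j _; apply: measurable_set_le => //.
  exact: measurable_tuple_psum.
apply: measurable_set_pre => //; apply: measurableT_comp => //.
exact: measurable_tuple_psum.
Qed.

Lemma measurable_record_event k A : measurable A -> measurable (record_event k A).
Proof. by move=> mA; apply: (sigma_process_measurable X_levy); exact: record_event_past. Qed.

Lemma measurable_descent_event k m B : measurable B -> measurable (descent_event k m B).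
Proof.
move=> mB; apply: measurableI.
  apply: measurable_set_forall => j _; apply: measurable_set_le => //.
  by apply: measurable_funB; exact: (measurable_grid X_levy).
apply: measurable_set_pre => //; apply: measurableT_comp => //.
by apply: measurable_funB; exact: (measurable_grid X_levy).
Qed.

Lemma grid_sup_record k m w A B : (k <= m)%N ->
  (record_event k A `&` descent_event k (m - k) B) w -> grid_sup m w = S k w.
Proof.
move=> km [[rec _] [des _]]; apply/le_anti/andP; split; last exact: grid_max_ub.
apply: grid_max_le => j jm; have [jk|kj] := ltnP j k; first exact/ltW/rec.
have := des (j - k)%N; rewrite subnKC // => /(_ _)/= H.
by rewrite -subr_le0 H // ltnS leq_sub2r.
Qed.

(* Split according to the first index at which the maximum is attained. *)
Lemma sup_event_split m A B :
  sup_event m A B =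
  \big[setU/set0]_(k < m.+1) (record_event k A `&` descent_event k (m - k) B).
Proof.
rewrite -(bigcup_mkord m.+1 (fun k => record_event k A `&` descent_event k (m - k) B)).
apply/seteqP; split=> w; last first.
  move=> [k /= km0 rd]; have km : (k <= m)%N := km0.
  have kE := grid_sup_record km rd.
  case: rd => [[_ Ak] [_ Bk]]; rewrite /sup_event /= kE; split=> //.
  by move: Bk; rewrite subnKC // opprB.
move=> [Aw Bw].
have ex : exists k, (k <= m)%N && (S k w == grid_sup m w).
  rewrite /grid_sup /grid_max; elim/big_ind: _ => //.
  - by exists 0; rewrite /S grid0 eqxx.
  - by move=> x y ex ey; rewrite /Num.max; case: ifP.
  - by move=> j _; exists j; rewrite -ltnS ltn_ord eqxx.
case: (ex_minnP ex) => k /andP[km /eqP kE] kmin; exists k => //.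
split; split.
- move=> j jk; rewrite lt_neqAle kE; apply/andP; split; last first.
    by apply: grid_max_ub; exact: ltnW (leq_trans jk km).
  apply/negP => jE; have := kmin j; rewrite jE (ltnW (leq_trans jk km)).
  by move=> /(_ isT); rewrite leqNgt jk.
- by rewrite kE.
- move=> j; rewrite ltnS => jm; rewrite subr_le0 kE; apply: grid_max_ub.
  by rewrite -(subnKC km) leq_add2l.
- by rewrite subnKC // opprB kE.
Qed.

Lemma pr_sup_event m A B : measurable A -> measurable B ->
  pr (sup_event m A B) =
  conv (fun k => pr (record_event k A)) (fun k => pr (descent_event 0 k B)) m.
Proof.
move=> mA mB; rewrite sup_event_split.
pose F k := if (k <= m)%N then record_event k A `&` descent_event k (m - k) B else set0.
have mF k : measurable (F k).
  rewrite /F; case: ifP => // _.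
  by apply: measurableI; [exact: measurable_record_event|exact: measurable_descent_event].
rewrite (eq_bigr (fun k : 'I_m.+1 => F k)); last first.
  by move=> k _; rewrite /F -ltnS ltn_ord.
rewrite /pr measure_semi_additive_ord_I //; last 2 first.
(* On an overlap both S i and S j equal the maximum, against the strict record at the larger
   index. *)
- move=> i j /= im jm [w [Fi Fj]]; move: Fi Fj im jm; rewrite /F !ltnS => + + im jm.
  rewrite im jm => Fi Fj.
  have eij : S i w = S j w by rewrite -(grid_sup_record im Fi) (grid_sup_record jm Fj).
  have [ij|ji|//] := ltngtP i j.
    by have := Fj.1.1 i ij; rewrite eij ltxx.
  by have := Fi.1.1 j ji; rewrite eij ltxx.
- by apply: bigsetU_measurable.
rewrite (eq_bigr (fun k : 'I_m.+1 => (pr (F k))%:E)); last first.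
  by move=> k _; rewrite fineK // fin_num_measure.
rewrite sumEFin /=; apply: eq_bigr => k _; rewrite /F -ltnS ltn_ord.
exact: record_descent_indep.
Qed.

Definition tuple_max m (x : m.-tuple R) : R := \big[Num.max/0]_(j < m.+1) tuple_psum x j.

Lemma measurable_tuple_max m : measurable_fun setT (@tuple_max m).
Proof.
apply: (@measurable_bigmax _ _ _ _ _ (fun=> 0)) => // j.
exact: measurable_tuple_psum.
Qed.

Lemma tuple_max_increments m w : tuple_max (increments X n 0 m w) = grid_sup m w.
Proof.
have S0 : S 0 w = 0 by rewrite /S grid0 (levy_start X_levy).
rewrite /tuple_max /grid_sup /grid_max (levy_start X_levy); apply: eq_bigr => j _.
have jm : (j <= m)%N by exact: (ltn_ord j).
by rewrite increments_psum // add0n -[X (grid n 0) w]/(S 0 w) S0 subr0.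
Qed.

(** The reversed walk has partial sums S_m - S_(m-j), so its maximum is S_m minus the minimum of the
    original walk. *)
Lemma tuple_max_rev m w :
  tuple_max (rev_increments X n m w) = S m w + grid_neg_inf m w.
Proof.
have S0 : S 0 w = 0 by rewrite /S grid0 (levy_start X_levy).
apply/le_anti/andP; split.
  apply/bigmax_leP; split=> [|j _].
    by rewrite addrC -lerBlDr sub0r; apply: (grid_max_ub (fun s => - X s w)).
  have jm : (j <= m)%N by exact: (ltn_ord j).
  rewrite rev_increments_psum // lerD2l.
  by apply: (grid_max_ub (fun s => - X s w)); exact: leq_subr.
rewrite addrC -lerBrDr; apply: grid_max_le => j jm.
rewrite lerBrDr addrC; have jm' : (m - j < m.+1)%N by rewrite ltnS leq_subr.
have := rev_increments_psum (X := X) n w (leq_subr j m); rewrite subKn // => <-.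
exact: (le_bigmax _ _ (Ordinal jm')).
Qed.

(** Both events pull back the same set [D] of increment vectors, one along the increments and the
    other along their reversal. *)
Lemma pr_sup_inf_event m A B : measurable A -> measurable B ->
  pr (sup_event m A B) = pr (inf_event m A B).
Proof.
move=> mA mB.
pose D := [set x : m.-tuple R | A (tuple_max x)] `&`
  [set x | B (tuple_max x - tuple_psum x m)].
have S0 w : S 0 w = 0 by rewrite /S grid0 (levy_start X_levy).
have mD : measurable D.
  apply: measurableI; apply: measurable_set_pre => //.
    exact: measurable_tuple_max.
  by apply: measurable_funB; [exact: measurable_tuple_max|exact: measurable_tuple_psum].
have -> : sup_event m A B = increments X n 0 m @^-1` D.
  apply/seteqP; split=> w; rewrite /D /= tuple_max_increments increments_psum // add0n;
    by rewrite -[X (grid n 0) w]/(S 0 w) S0 subr0.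
rewrite /pr (increments_reverse X_levy) //; congr (fine (P _)).
have E w : X (grid n m) w + grid_neg_inf m w - (X (grid n m) w - X (grid n 0) w) =
    grid_neg_inf m w by rewrite -[X (grid n 0) w]/(S 0 w) S0; ring.
apply/seteqP; split=> w; rewrite /D /= tuple_max_rev rev_increments_psum // subnn;
  by rewrite E.
Qed.

(** The law of the maximum is the case B = [setT] of the splitting; that of minus the minimum is, by
    reversal, the case A = [setT]. With both equal to [setT] the event is everything, which supplies
    the constant convolution 1 for [conv_swap]. *)
Lemma grid_factorization m A B : measurable A -> measurable B ->
  \sum_(k < m.+1) pr (sup_event k A B) =
  conv (fun k => pr [set w | A (grid_sup k w)])
       (fun k => pr [set w | B (grid_neg_inf k w)]) m.
Proof.
move=> mA mB.
have E1 k : pr [set w | A (grid_sup k w)] =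
    conv (fun k => pr (record_event k A)) (fun k => pr (descent_event 0 k setT)) k.
  rewrite -pr_sup_event //; congr pr.
  by apply/seteqP; split=> w /=; [split|case].
have E2 k : pr [set w | B (grid_neg_inf k w)] =
    conv (fun k => pr (record_event k setT)) (fun k => pr (descent_event 0 k B)) k.
  rewrite -pr_sup_event // pr_sup_inf_event //; congr pr.
  by apply/seteqP; split=> w /=; [split|case].
rewrite (eq_bigr (fun k : 'I_m.+1 => conv (fun k => pr (record_event k A))
   (fun k => pr (descent_event 0 k B)) k)); last by move=> k _; rewrite pr_sup_event.
rewrite (@conv_swap _ _ _ (fun k => pr (record_event k setT))
  (fun k => pr (descent_event 0 k setT))); last first.
  move=> k; rewrite -pr_sup_event //.
  rewrite (_ : sup_event k setT setT = setT) ; first exact: pr_setT.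
  by apply/seteqP; split.
by apply: eq_bigr => j _; rewrite E1 E2.
Qed.

End GridFactorization.

Arguments grid_sup {d Omega R} X n k w.
Arguments grid_neg_inf {d Omega R} X n k w.
Arguments sup_event {d Omega R} X n k A B _.
Arguments inf_event {d Omega R} X n k A B _.

(** * Riemann sums with exponentially decaying weights *)

Section ExponentiallyBoundedWeights.
Context {R : realType}.
Implicit Types (w f psi : R -> R) (c : nat -> R).
Local Notation mu := (@lebesgue_measure R).
Local Notation D := (`[0, +oo[%classic : set R).

Definition exp_bounded w : Prop := exists2 r : R, 0 < r & exists2 C : R, 0 <= C &
  forall u, 0 <= u -> `|w u| <= C * expR (- r * u).

Lemma integrable_expR (r C : R) : 0 < r ->
  mu.-integrable D (fun u => (C * expR (- r * u))%:E).
Proof.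
move=> r0; have iS : mu.-integrable D (EFin \o exponential_pdf r).
  by apply: integrableS (integrable_exponential_pdf r0).
have : mu.-integrable D (fun u => (C / r)%:E * (EFin \o exponential_pdf r) u)%E.
  exact: integrableZl.
apply: eq_integrable => //.
move=> u; rewrite inE /= in_itv /= andbT => u0.
rewrite -EFinM exponential_pdfE // mulrA divfK ?gt_eqF //.
Qed.

Lemma exp_bounded_integrable w : measurable_fun D w -> exp_bounded w ->
  mu.-integrable D (EFin \o w).
Proof.
move=> mw [r r0 [C C0 wC]].
apply: (le_integrable _ _ _ (integrable_expR C r0)) => //.
  exact/measurable_EFinP.
move=> u; rewrite /= in_itv /= andbT => u0.
by rewrite /= lee_fin (le_trans (wC u u0)) ?ler_norm.
Qed.

Lemma exp_boundedM w f : exp_bounded w -> (forall u, 0 <= u -> `|f u| <= 1) ->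
  exp_bounded (fun u => w u * f u).
Proof.
move=> [r r0 [C C0 wC]] f1; exists r => //; exists C => // u u0.
by rewrite normrM -[leRHS]mulr1 ler_pM ?wC ?f1.
Qed.

(** Dominated convergence with a countable, hence Lebesgue null, set of exceptional times. *)
Lemma exp_bounded_dominated (f : nat -> R -> R) (g : R -> R) (Ex : set R) (r C : R) :
  countable Ex -> 0 < r ->
  (forall n, measurable_fun D (f n)) -> measurable_fun D g ->
  (forall n u, 0 <= u -> `|f n u| <= C * expR (- r * u)) ->
  (forall u, 0 <= u -> ~ Ex u -> f n u @[n --> \oo] --> g u) ->
  Rintegral mu D (f n) @[n --> \oo] --> Rintegral mu D g.
Proof.
move=> cE r0 mf mg fC fg.
have [||||||ig _ cv] := @dominated_convergence _ _ _ mu D _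
  (fun n => EFin \o f n) (EFin \o g) (fun u => (C * expR (- r * u))%:E).
- exact: measurable_itv.
- by move=> n; apply/measurable_EFinP; exact: (mf n).
- by apply/measurable_EFinP; exact: mg.
- exists Ex; split; first by apply: countable_measurable.
    exact: countable_lebesgue_measure0.
  move=> u /= Hu; apply: contrapT => Eu; apply: Hu; rewrite in_itv /= andbT => u0.
  by apply: cvg_EFin; [exact: nearW|exact: fg].
- exact: integrable_expR.
- apply: aeW => u n; rewrite /= in_itv /= andbT => u0.
  by rewrite lee_fin fC.
apply: fine_cvg; rewrite fineK //; exact: integrable_fin_num.
Qed.

(** Cells of width 1 / (n + 1) then fill [0, n + 1[, so that one index refines the mesh and extends
    the horizon together. *)
Definition step_size (n : nat) : nat := (n.+1 * n.+1)%N.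

Definition cell n k : set R := `[grid n k, grid n k.+1[%classic.

Lemma measurable_cell n k : measurable (cell n k).
Proof. exact: measurable_itv. Qed.

(* Cells carry the value at their right end point, so that right continuity
   of the paths gives convergence as the mesh is refined. *)
Definition step_fun n c (u : R) : R :=
  \sum_(k < step_size n) \1_(cell n k) u * c k.+1.

Lemma grid_step_size n : grid n (step_size n) = n.+1%:R :> R.
Proof. by rewrite /grid natrM mulfK. Qed.

Lemma step_funE n c u : 0 <= u ->
  step_fun n c u = if u < n.+1%:R then c (next_index n u) else 0.
Proof.
move=> u0; rewrite /step_fun.
have inE' k : u \in (cell n k) -> next_index n u = k.+1.
  by rewrite inE /cell /= in_itv /= => /andP[]; exact: next_index_def.
have [un|un] := ltP u n.+1%:R; last first.
  apply: big1 => k _; rewrite indicE; case: (boolP (u \in _)) => [/[dup] /inE' _|_].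
    rewrite inE /cell /= in_itv /= => /andP[_ uk].
    have : grid n k.+1 <= n.+1%:R :> R by rewrite -grid_step_size le_grid.
    by move=> /(lt_le_trans uk); rewrite ltNge un.
  by rewrite mul0r.
have kP : ((next_index n u).-1 < step_size n)%N.
  rewrite -(lt_grid (R := R) n) grid_step_size; exact: le_lt_trans (next_index_le n u0) un.
rewrite (bigD1 (Ordinal kP)) //= big1 ?addr0.
  rewrite indicE mem_set ?mul1r //= /cell /= in_itv /= next_index_le //.
  by rewrite [X in grid n X](_ : _ = next_index n u) ?next_index_gt.
move=> k kne; rewrite indicE; case: (boolP (u \in _)) => [/inE' kE|_]; last by rewrite mul0r.
by case/eqP: kne; apply/val_inj; rewrite -[RHS]/((next_index n u).-1) kE.
Qed.

Lemma step_fun_norm n c u : 0 <= u -> (forall k, `|c k| <= 1) -> `|step_fun n c u| <= 1.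
Proof. by move=> u0 c1; rewrite step_funE //; case: ifP => // _; rewrite normr0. Qed.

Lemma measurable_step_fun n c E : measurable_fun E (step_fun n c).
Proof.
apply: measurable_funTS; apply: measurable_sum => k.
by apply: measurable_funM => //; apply: measurable_indic; exact: measurable_cell.
Qed.

Lemma cell_sub n k : (cell n k) `<=` D.
Proof.
by move=> u; rewrite /cell /= !in_itv /= andbT => /andP[+ _]; apply: le_trans; exact: grid_ge0.
Qed.

Lemma Rintegral_step n c w : measurable_fun D w ->
  (forall k, mu.-integrable (cell n k) (EFin \o w)) ->
  Rintegral mu D (fun u => w u * step_fun n c u) =
  \sum_(k < step_size n) Rintegral mu (cell n k) w * c k.+1.
Proof.
move=> mw iw.
have eqk k : (fun u => (w u * (\1_(cell n k) u * c k.+1))%:E) =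
    (fun u => (c k.+1)%:E * ((EFin \o w) \_ (cell n k)) u)%E.
  apply/funext => u; rewrite patchE indicE; case: ifP => _ /=.
    by rewrite mul1r -EFinM mulrC.
  by rewrite mul0r mulr0 mule0.
have ik k : mu.-integrable D ((EFin \o w) \_ (cell n k)).
  apply/integrable_restrict; first exact: measurable_itv.
  exact: measurable_itv.
  by rewrite setIidr; [exact: iw|exact: cell_sub].
rewrite {1}/Rintegral.
under eq_integral do rewrite /step_fun mulr_sumr -sumEFin.
rewrite integral_sum //; last by move=> k; rewrite eqk; exact: integrableZl.
rewrite (eq_bigr (fun k : 'I_(step_size n) =>
   (Rintegral mu (cell n k) w * c k.+1)%:E)) ?sumEFin // => k _.
rewrite eqk integralZl // -integral_mkcondr setIidr; last exact: cell_sub.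
rewrite EFinM muleC /Rintegral fineK //.
by apply: integrable_fin_num; [exact: measurable_itv|exact: iw].
Qed.

Lemma cell_measure n k : mu (cell n k) = (n.+1%:R^-1)%:E.
Proof.
rewrite /cell lebesgue_measure_itv /= lte_fin lt_grid ltnSn -EFinB.
by rewrite -addn1 gridD addrC addKr /grid mul1r.
Qed.

Lemma cell_length n k : fine (mu (cell n k)) = n.+1%:R^-1.
Proof. by rewrite cell_measure. Qed.

Lemma cell_integrable_cst n k (r : R) : mu.-integrable (cell n k) (EFin \o cst r).
Proof.
apply/integrableP; split; first exact/measurable_EFinP/measurable_cst.
rewrite (eq_integral (cst `|r%:E|%E)) // integral_cst; last exact: measurable_itv.
by rewrite [X in (_ * X)%E](_ : _ = (n.+1%:R^-1)%:E) -?EFinM ?ltry //; exact: cell_measure.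
Qed.

Lemma cell_integrable n k w : measurable_fun D w -> exp_bounded w ->
  mu.-integrable (cell n k) (EFin \o w).
Proof.
move=> mw we; apply: integrableS (exp_bounded_integrable mw we); last exact: cell_sub.
  exact: measurable_itv.
exact: measurable_itv.
Qed.

Lemma cvg_cell_sums w (c : nat -> nat -> R) psi (Ex : set R) : countable Ex ->
  measurable_fun D w -> exp_bounded w -> measurable_fun D psi ->
  (forall n k, `|c n k| <= 1) ->
  (forall u, 0 <= u -> ~ Ex u -> c n (next_index n u) @[n --> \oo] --> psi u) ->
  \sum_(k < step_size n) Rintegral mu (cell n k) w * c n k.+1
    @[n --> \oo] --> Rintegral mu D (fun u => w u * psi u).
Proof.
move=> cE mw we mpsi c1 cpsi; have [r r0 [C C0 wC]] := we.
rewrite (_ : (fun n => _) =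
    (fun n => Rintegral mu D (fun u => w u * step_fun n (c n) u))); last first.
  by apply/funext => n; rewrite Rintegral_step // => k; exact: cell_integrable.
apply: (exp_bounded_dominated (C := C) cE r0) => [n||n u u0|u u0 Eu].
- by apply: measurable_funM => //; exact: measurable_step_fun.
- exact: measurable_funM.
- by rewrite normrM -[leRHS]mulr1 ler_pM ?wC ?step_fun_norm.
apply: cvgMl_tmp; apply: cvg_trans (cpsi u u0 Eu); apply: near_eq_cvg; near=> n.
rewrite step_funE // ifT //; near: n; exists (Num.truncn u).+1 => // n /= un.
apply: lt_trans (truncnS_gt u) _; by rewrite ltr_nat.
Unshelve. all: by end_near. Qed.

(** Up to an edge term, the difference is the integral of (w(u) - w(next grid point)) times a
    coefficient of size at most 1. Continuity of [w] and domination finish, so the comparison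
    applies to joint laws before their limit is known. *)
Lemma cell_sums_riemann w (c : nat -> nat -> R) : continuous w -> exp_bounded w ->
  (forall n k, `|c n k| <= 1) ->
  \sum_(k < step_size n) Rintegral mu (cell n k) w * c n k.+1 -
  n.+1%:R^-1 * \sum_(j < step_size n) w (grid n j) * c n j
    @[n --> \oo] --> (0 : R).
Proof.
move=> cw we c1; have [r r0 [C C0 wC]] := we.
have mw : measurable_fun D w by apply: measurable_funTS; exact: continuous_measurable_fun.
have tn n (u : R) : 0 <= u -> u <= grid n (next_index n u).
  by move=> u0; exact/ltW/next_index_gt.
(* Reading [w] at the right end point keeps the bound at u, because the exponential bound
   decreases. *)
have wt n (u : R) : 0 <= u -> `|w (grid n (next_index n u))| <= C * expR (- r * u).
  move=> u0; apply: le_trans (wC _ (le_trans u0 (tn n u u0))) _.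
  by rewrite ler_wpM2l // ler_expR !mulNr lerN2 ler_pM2l // tn.
pose g n (k : nat) := w (grid n k) * c n k.
pose f n u := w u * step_fun n (c n) u - step_fun n (g n) u.
have intf : Rintegral mu D (f n) @[n --> \oo] --> (0 : R).
  suff : Rintegral mu D (f n) @[n --> \oo] --> Rintegral mu D (fun=> (0 : R)).
    by rewrite Rintegral_cst ?mul0r //; exact: measurable_itv.
  apply: (@exp_bounded_dominated f (fun=> 0) set0 r (2 * C)) => //.
  - by move=> n; apply: measurable_funB; first apply: measurable_funM => //;
      exact: measurable_step_fun.
  - move=> n u u0; rewrite /f !step_funE //; case: ifP => _; last first.
      by rewrite mulr0 subr0 normr0 !mulr_ge0 ?expR_ge0.
    rewrite /g -mulrBl normrM -[leRHS]mulr1 ler_pM //.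
    apply: le_trans (ler_normB _ _) _.
    by rewrite -mulrA mulr_natl mulr2n lerD ?wC ?wt.
  move=> u u0 _; apply/cvgrPdist_lt => e e0.
  have : w (grid n (next_index n u)) @[n --> \oo] --> w u.
    by apply: (cvg_comp _ _ (cvg_next_grid u0)); exact: cw.
  move=> /cvgrPdist_lt/(_ e e0) wcv.
  near=> n; rewrite sub0r normrN /f !step_funE //; case: ifP => _; last first.
    by rewrite mulr0 subr0 normr0.
  rewrite /g -mulrBl normrM.
  apply: (@le_lt_trans _ _ `|w u - w (grid n (next_index n u))|).
    by rewrite -[leRHS]mulr1 ler_pM.
  by near: n.
have gC n k : `|g n k| <= C.
  rewrite normrM -[leRHS]mulr1 ler_pM //.
  apply: le_trans (wC _ (grid_ge0 _ _)) _; rewrite -[leRHS]mulr1 ler_wpM2l //.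
  by rewrite -expR0 ler_expR mulNr oppr_le0 mulr_ge0 ?grid_ge0 // ltW.
(* Cells carry indices 1 to N while the Riemann sum runs from 0 to N - 1; the shift leaves these two
   end terms. *)
have edge : n.+1%:R^-1 * (g n (step_size n) - g n 0) @[n --> \oo] --> (0 : R).
  apply/cvgrPdist_le => e e0.
  have C1 : 0 < 2 * C + 1 by lra.
  have Ce : 0 < e / (2 * C + 1) by rewrite divr_gt0.
  near=> n; rewrite sub0r normrN normrM.
  have dn : (n.+1%:R : R)^-1 < e / (2 * C + 1) by near: n; exact: invSn_near.
  rewrite ger0_norm ?invr_ge0 //.
  apply: (@le_trans _ _ (e / (2 * C + 1) * (2 * C + 1))); last first.
    by rewrite divfK // gt_eqF.
  apply: ler_pM => //; first exact: ltW.
  apply: le_trans (ler_normB _ _) _.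
  by apply: (@le_trans _ _ (2 * C)); [rewrite mulr_natl mulr2n lerD|rewrite lerDl].
rewrite (_ : (fun n => _) = (fun n => Rintegral mu D (f n) +
    n.+1%:R^-1 * (g n (step_size n) - g n 0))); last first.
  apply/funext => n; rewrite RintegralB; last 3 first.
  - exact: measurable_itv.
  - apply: exp_bounded_integrable.
      by apply: measurable_funM => //; exact: measurable_step_fun.
    by apply: exp_boundedM => // u u0; exact: step_fun_norm.
  - apply: exp_bounded_integrable; first exact: measurable_step_fun.
    exists r => //; exists C => // u u0; rewrite step_funE //; case: ifP => _.
      by rewrite normrM -[leRHS]mulr1 ler_pM ?wt.
    by rewrite normr0 mulr_ge0 ?expR_ge0.
  have -> : Rintegral mu D (step_fun n (g n)) =
      n.+1%:R^-1 * \sum_(k < step_size n) g n k.+1.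
    rewrite (_ : step_fun n (g n) = fun u => 1 * step_fun n (g n) u); last first.
      by apply/funext => u; rewrite mul1r.
    rewrite (@Rintegral_step n (g n) (fun=> 1)) //; last first.
      by move=> k; exact: cell_integrable_cst.
    rewrite mulr_sumr; apply: eq_bigr => k _.
    rewrite Rintegral_cst; last exact: measurable_itv.
    by rewrite cell_length mul1r.
  rewrite Rintegral_step //; last by move=> k; exact: cell_integrable.
  have shift : \sum_(j < step_size n) g n j + g n (step_size n) =
      g n 0 + \sum_(j < step_size n) g n j.+1.
    by rewrite -(big_ord_recr (step_size n) (fun j : 'I__ => g n j)) big_ord_recl.
  rewrite -addrA; congr (_ + _).
  rewrite -[X in - (_ * X)]/(\sum_(j < step_size n) g n j).
  have -> : g n (step_size n) =
      g n 0 + \sum_(j < step_size n) g n j.+1 - \sum_(j < step_size n) g n j.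
    by rewrite -shift addrAC subrr add0r.
  ring.
rewrite -[X in _ --> X]addr0; exact: cvgD.
Unshelve. all: by end_near. Qed.

End ExponentiallyBoundedWeights.

(** * Laws of running suprema *)

Section ProbabilityLimits.
Context {d : measure_display} {Omega : measurableType d} {R : realType}.
Variable P : probability Omega R.
Let pr (E : set Omega) : R := fine (P E).

Lemma pr_le1 E : measurable E -> 0 <= pr E <= 1.
Proof.
move=> mE; rewrite fine_ge0 //= -lee_fin fineK ?fin_num_measure //.
exact: probability_le1.
Qed.

Lemma pr_norm E : measurable E -> `|pr E| <= 1.
Proof. by move=> mE; have /andP[p0 p1] := pr_le1 mE; rewrite ger0_norm. Qed.

(** Dominated convergence for indicators, which off the null set [N] are eventually constant. *)
Lemma cvg_pr (A : nat -> set Omega) (B N : set Omega) :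
  (forall n, measurable (A n)) -> measurable B -> measurable N -> P N = 0%E ->
  (forall w, ~ N w -> B w -> \forall n \near \oo, A n w) ->
  (forall w, ~ N w -> ~ B w -> \forall n \near \oo, ~ A n w) ->
  pr (A n) @[n --> \oo] --> pr B.
Proof.
move=> mA mB mN N0 AB AB'.
have [||||||_ _ cv] := @dominated_convergence _ _ _ P setT _
  (fun n w => (\1_(A n) w)%:E) (fun w => (\1_B w)%:E) (cst 1%E).
- exact: measurableT.
- by move=> n; apply/measurable_EFinP; exact: measurable_indic.
- by apply/measurable_EFinP; exact: measurable_indic.
- exists N; split=> // w /= H; apply: contrapT => Nw; apply: H => _.
  rewrite !indicE; case: (pselect (B w)) => Bw.
    rewrite mem_set //; apply: cvg_near_cst; apply: filterS (AB w Nw Bw) => n Aw.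
    by rewrite indicE mem_set.
  rewrite memNset //; apply: cvg_near_cst; apply: filterS (AB' w Nw Bw) => n Aw.
  by rewrite indicE memNset.
- by apply: finite_measure_integrable_cst.
- by apply: aeW => w n _; rewrite lee_fin indicE; case: (_ \in _); rewrite ?normr1 ?normr0.
have iE E : measurable E -> (\int[P]_(w in setT) (\1_E w)%:E = P E)%E.
  by move=> mE; rewrite integral_indic // setIT.
apply: fine_cvg; rewrite fineK; last exact: fin_num_measure.
rewrite -iE //.
rewrite (_ : (fun n => P (A n)) = fun n => (\int[P]_(w in setT) (\1_(A n) w)%:E)%E) //.
by apply/funext => n; rewrite iE.
Qed.

Local Notation mu := (@lebesgue_measure R).
Local Notation D := (`[0, +oo[%classic : set R).

Section WeightedLaw.
Variable f : R -> Omega -> R.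
Hypothesis mf : forall u, 0 <= u -> measurable_fun setT (f u).
Hypothesis mhalf : forall a, measurable_fun D (fun u => pr [set w | a < f u w]).

Lemma law_continuous_additive u : 0 <= u ->
  continuous_additive (fun A => pr [set w | A (f u w)]).
Proof.
move=> u0.
rewrite (_ : (fun A => _) = fun A => pr (setT `&` f u @^-1` A)).
  by apply: continuous_additive_prob => //; exact: mf.
by apply/funext => A; rewrite setTI.
Qed.

(** Measurability in time passes from half-lines to Borel sets by a lambda-system argument, since
    differences and monotone limits of measurable functions are measurable. *)
Lemma measurable_law A : measurable A ->
  measurable_fun D (fun u => pr [set w | A (f u w)]).
Proof.
rewrite [X in X A -> _](@half_lines_generate R set0); last exact: countable0.
move=> GA.
suff [] : (measurable `&`
  [set A | measurable_fun D (fun u => pr [set w | A (f u w)])]) A by [].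
move: A GA; apply: (@lambda_system_subset _ (half_lines set0) _ setT) => //.
- exact: half_linesI.
- split=> //.
  + by split => //; exact: (@measurable_cst _ _ _ _ D (pr setT)).
  + move=> A B BA [mA eA] [mB eB]; split; first exact: measurableD.
    apply: (eq_measurable_fun (fun u => pr [set w | A (f u w)] - pr [set w | B (f u w)])).
      move=> u; rewrite inE /= in_itv /= andbT => u0.
      have [ad _] := law_continuous_additive u0.
      rewrite -{1}(setDUK BA) ad //; [by ring|exact: measurableD|exact: setDIK].
    exact: measurable_funB.
  + move=> F ndF KF; have mF n : measurable (F n) by have [] := KF n.
    split; first exact: bigcupT_measurable.
    apply: (@measurable_fun_cvg _ _ _ _ (fun n u => pr [set w | F n (f u w)])).
      by move=> n; have [] := KF n.
    move=> u; rewrite /= in_itv /= andbT => u0.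
    have [_ ct] := law_continuous_additive u0; exact: ct.
- move=> _ [a _ <-]; split; first exact: measurable_itvoy.
  apply: eq_measurable_fun (mhalf a) => u _; congr pr.
  by apply/seteqP; split=> w /=; rewrite in_itv /= andbT.
Qed.

Lemma weighted_law_integrable w A : measurable_fun D w -> exp_bounded w -> measurable A ->
  mu.-integrable D (EFin \o (fun u => w u * pr [set w | A (f u w)])).
Proof.
move=> mw we mA; apply: exp_bounded_integrable.
  by apply: measurable_funM => //; exact: measurable_law.
apply: exp_boundedM => // u u0; apply: pr_norm.
by apply: measurable_set_pre => //; exact: mf.
Qed.

Lemma weighted_law_continuous_additive w : measurable_fun D w -> exp_bounded w ->
  continuous_additive (fun A => Rintegral mu D (fun u => w u * pr [set w | A (f u w)])).
Proof.
move=> mw we; split=> [A B mA mB AB|F mF ndF].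
  rewrite -RintegralD; last 3 first.
  - exact: measurable_itv.
  - exact: weighted_law_integrable.
  - exact: weighted_law_integrable.
  apply: eq_Rintegral => u; rewrite inE /= in_itv /= andbT => u0.
  by have [ad _] := law_continuous_additive u0; rewrite -mulrDr -ad.
have [r r0 [C C0 wC]] := we.
have mU : measurable (\bigcup_n F n) by exact: bigcupT_measurable.
apply: (exp_bounded_dominated (C := C) (@countable0 R) r0).
- by move=> n; apply: measurable_funM => //; exact: measurable_law.
- by apply: measurable_funM => //; exact: measurable_law.
- move=> n u u0; rewrite normrM -[leRHS]mulr1 ler_pM ?wC // pr_norm //.
  by apply: measurable_set_pre => //; exact: mf.
- move=> u u0 _; apply: cvgMl_tmp.
  by have [_ ct] := law_continuous_additive u0; exact: ct.
Qed.

End WeightedLaw.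

Section CadlagProcess.
Variable Z : R -> Omega -> R.
Hypothesis mZ : forall u, 0 <= u -> measurable_fun setT (Z u).
Hypothesis rcZ : forall w (t : R), 0 <= t -> Z s w @[s --> t^'+] --> Z t w.
Hypothesis llZ : forall w (t : R), 0 < t -> cvg (Z s w @[s --> t^'-]).

Let M u w : R := path_sup (Z^~ w) u.
Let Mn n k w : R := grid_max (Z^~ w) n k.

Lemma measurable_grid_max n k : measurable_fun setT (Mn n k).
Proof.
apply: measurable_bigmax; first exact: mZ.
by move=> j; apply: mZ; exact: grid_ge0.
Qed.

Lemma cvg_grid_max_path u w : 0 <= u -> Mn n (next_index n u) w @[n --> \oo] --> M u w.
Proof. by move=> u0; apply: cvg_grid_max; [exact: rcZ|exact: llZ|]. Qed.

Lemma measurable_path_sup u : 0 <= u -> measurable_fun setT (M u).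
Proof.
move=> u0; apply: (@measurable_fun_cvg _ _ _ _ (fun n => Mn n (next_index n u))).
  by move=> n; exact: measurable_grid_max.
by move=> w _; exact: cvg_grid_max_path.
Qed.

Lemma measurable_sup_gt a u : 0 <= u -> measurable [set w | a < M u w].
Proof.
by move=> u0; apply: measurable_set_lt => //; exact: measurable_path_sup.
Qed.

Lemma measurable_pr_sup_gt a : measurable_fun D (fun u => pr [set w | a < M u w]).
Proof.
(* The running supremum grows with time; clamping at 0 makes the probability monotone on the whole
   line, hence measurable. *)
apply: (eq_measurable_fun (fun u : R => pr [set w | a < M (Num.max 0 u) w])).
  by move=> u; rewrite inE /= in_itv /= andbT => u0; rewrite max_r.
apply: nondecreasing_measurable; first exact: measurable_itv.
move=> u v uv; have m0 (t : R) : 0 <= Num.max 0 t by rewrite le_max lexx.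
apply: fine_le; rewrite ?fin_num_measure //; try exact: measurable_sup_gt.
apply: le_measure; rewrite ?inE; try exact: measurable_sup_gt.
move=> w /= /lt_le_trans; apply; apply: path_sup_mono => //; first exact: rcZ.
  exact: llZ.
by rewrite ge_max le_max lexx /= le_max uv orbT.
Qed.

(* For the exceptional [u], the level [a] is first exceeded exactly at time
   [u] with positive probability. *)
Lemma cvg_pr_grid_max_gt a : exists2 Ex : set R, countable Ex &
  forall u, 0 <= u -> ~ Ex u ->
    pr [set w | a < Mn n (next_index n u) w] @[n --> \oo] --> pr [set w | a < M u w].
Proof.
pose E u := if 0 <= u then ~` [set w | a < M u w] `&`
  \bigcap_m [set w | a < M (u + m.+1%:R^-1) w] else set0.
have u1 (u : R) m : 0 <= u -> 0 <= u + m.+1%:R^-1 by move=> u0; rewrite addr_ge0 // invr_ge0.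
have mE u : measurable (E u).
  rewrite /E; case: ifP => // u0; apply: measurableI.
    by apply: measurableC; exact: measurable_sup_gt.
  by apply: bigcapT_measurable => m; apply: measurable_sup_gt; exact: u1.
(* Exceeding [a] right after u means exceeding it before v. The events are thus disjoint, and only
   countably many have positive probability. *)
have nE u v w : u < v -> E u w -> ~ E v w.
  rewrite /E => uv; case: ifP => // u0 [_ Hu]; rewrite (le_trans u0 (ltW uv)) => -[Hv _].
  apply: Hv => /=.
  have vu : 0 < v - u by rewrite subr_gt0.
  have [m _ /(_ m (leqnn m)) /= mv] := invSn_near vu.
  apply: lt_le_trans (Hu m I) _; apply: path_sup_mono; [exact: rcZ|exact: llZ|exact: u1|].
  by rewrite addrC -lerBrDr ltW.
have tE : trivIset setT E.
  move=> u v _ _ [w [Eu Ev]]; have [uv|vu|//] := ltgtP u v.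
    by case: (nE _ _ _ uv Eu).
  by case: (nE _ _ _ vu Ev).
exists [set u | P (E u) != 0%E]; first exact: countable_pos_prob.
move=> u u0 /negP; rewrite negbK => /eqP PE0.
apply: (cvg_pr _ _ (mE u) PE0).
- by move=> n; apply: measurable_set_lt => //; exact: measurable_grid_max.
- exact: measurable_sup_gt.
- move=> w _ /= aM; have /cvgrPdist_lt := cvg_grid_max_path (w := w) u0.
  move=> /(_ (M u w - a)); rewrite subr_gt0 => /(_ aM); apply: filterS => n /=.
  by rewrite ltr_distlC => /andP[+ _]; rewrite opprB addrC subrK.
(* Off [E u], a supremum at most [a] at time u stays so for a little longer, and for a fine mesh the
   next grid point falls within that delay. *)
move=> w; rewrite /E u0 => nEw /= nM.
have [m /negP nm] : exists m, ~~ (a < M (u + m.+1%:R^-1) w).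
  apply: contrapT => H; apply: nEw; split=> // m _ /=.
  by apply: contrapT => /negP Hm; apply: H; exists m.
have v0 : 0 < (m.+1%:R : R)^-1 by rewrite invr_gt0.
apply: filterS (invSn_near v0) => n nv /=; apply/negP; rewrite -leNgt.
move: nm => /negP; rewrite -leNgt; apply: le_trans.
apply: grid_max_le => j jn.
apply: (@path_sup_ub _ (Z^~ w)); [exact: rcZ|exact: llZ|exact: grid_ge0|].
apply: (@le_trans _ _ (grid n (next_index n u))); first by rewrite le_grid.
by apply: le_trans (next_index_le_grid n u0) _; rewrite lerD2l ltW.
Qed.

End CadlagProcess.
End ProbabilityLimits.

(** * The discretized brackets *)

Section MatrixLimits.
Context {R : realType}.

Lemma cvg_mulmx_entries (m p q : nat) (F : nat -> 'M[R]_(m, p)) (G : nat -> 'M[R]_(p, q))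
    (A : 'M[R]_(m, p)) (B : 'M[R]_(p, q)) :
  (forall i j, F n i j @[n --> \oo] --> A i j) ->
  (forall i j, G n i j @[n --> \oo] --> B i j) ->
  forall i j, (F n *m G n) i j @[n --> \oo] --> (A *m B) i j.
Proof.
move=> FA GB i j; rewrite mxE; under eq_cvg do rewrite mxE.
by apply: cvg_sum_seq => l; exact: cvgM.
Qed.

(** The fourth-order term (r x)^4 / 4! of the exponential series beats the cube; 24 is 4!. The cube
    arises as N^2 = (n + 1)^4 from the truncation error times the mesh. *)
Lemma cubic_expR_cvg0 (r : R) : 0 < r ->
  n.+1%:R ^+ 3 * expR (- r * n.+1%:R) @[n --> \oo] --> (0 : R).
Proof.
move=> r0; apply/cvgrPdist_lt => e e0.
have r4 : 0 < r ^+ 4 by rewrite exprn_gt0.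
have e1 : 0 < e * r ^+ 4 / 24 by rewrite divr_gt0 // mulr_gt0.
apply: filterS (invSn_near e1) => n; set x : R := n.+1%:R => nx.
have x0 : 0 < x by rewrite /x.
rewrite sub0r normrN ger0_norm ?mulr_ge0 ?expR_ge0 ?exprn_ge0 // ?ltW //.
have rx : 0 <= r * x by rewrite mulr_ge0 // ltW.
have := expR_ge1Dxn 3 rx; rewrite mulNr expRN => le.
have ex0 := expR_gt0 (r * x).
rewrite ltr_pdivrMr //.
apply: lt_le_trans (_ : e * ((r * x) ^+ 4 / 4`!%:R) <= _); last first.
  by rewrite ler_wpM2l ?(ltW e0) //; apply: le_trans le; rewrite lerDr.
have f4 : 4`!%:R = 24 :> R by rewrite (_ : 4`! = 24)%N.
rewrite f4.
have x3 : 0 < x ^+ 3 by rewrite exprn_gt0.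
have xV : x^-1 * x = 1 by rewrite mulVf // gt_eqF.
have : x ^+ 3 * (x^-1 * x) < x ^+ 3 * (e * r ^+ 4 / 24 * x).
  by rewrite ltr_pM2l // ltr_pM2r.
rewrite xV mulr1 exprMn.
by rewrite (_ : x ^+ 3 * (e * r ^+ 4 / 24 * x) = e * (r ^+ 4 * x ^+ 4 / 24)) //; ring.
Qed.

Context {p : nat}.
Variable T : 'M[R]_p.
Hypothesis T_stable : stable_mx T.

Lemma continuous_expmx i j : continuous (fun u : R => expmx (u *: T) i j).
Proof.
move=> u; apply/differentiable_continuous/derivable1_diffP.
by have [] := is_derive_expmx_l T u i j.
Qed.

Lemma exp_bounded_expmx i j : exp_bounded (fun u => expmx (u *: T) i j).
Proof.
have [r r0 [C C0 H]] := expmx_decay T_stable.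
by exists r => //; exists C => // u; exact: H.
Qed.

Lemma me_densityE alpha t u : me_density alpha T t u =
  \sum_i (\sum_j alpha 0 j * expmx (u *: T) j i) * t i 0.
Proof. by rewrite /me_density mxE; apply: eq_bigr => i _; rewrite mxE. Qed.

Lemma continuous_me_density alpha t : continuous (me_density alpha T t).
Proof.
rewrite (_ : me_density alpha T t = fun u =>
  \sum_i (\sum_j alpha 0 j * expmx (u *: T) j i) * t i 0); last first.
  by apply/funext => u; exact: me_densityE.
move=> u; apply: cvg_big => [|i _]; first by move=> -[x y]; exact: add_continuous.
apply: cvgMr_tmp; apply: cvg_big => [|j _]; first by move=> -[x y]; exact: add_continuous.
by apply: cvgMl_tmp; exact: continuous_expmx.
Qed.

Lemma exp_bounded_me_density alpha t : exp_bounded (me_density alpha T t).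
Proof.
have [r r0 [C C0 H]] := expmx_decay T_stable.
exists r => //; exists (\sum_i (\sum_j `|alpha 0 j| * C) * `|t i 0|).
  by apply: sumr_ge0 => i _; rewrite mulr_ge0 // sumr_ge0 // => j _; rewrite mulr_ge0.
move=> u u0; rewrite me_densityE mulr_suml (le_trans (ler_norm_sum _ _ _)) //.
apply: ler_sum => i _; rewrite normrM mulrAC ler_wpM2r // mulr_suml.
rewrite (le_trans (ler_norm_sum _ _ _)) //; apply: ler_sum => j _.
by rewrite normrM -mulrA ler_wpM2l // H.
Qed.

(** The derivative of the exponential at 0, read along steps 1 / (n + 1); this is where the factor
    [- T] of the second bracket comes from. *)
Lemma expmx_difference_quotient i j :
  (n.+1%:R *: (1 - expmx (grid n 1 *: T))) i j @[n --> \oo] --> (- T) i j.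
Proof.
have [/cvg_ex[l lE]] := is_derive_expmx_l T 0 i j.
rewrite /derive (cvg_lim _ lE) // expmx0 mulmx1 => lT.
have h0 : (grid n 1 : R) @[n --> \oo] --> (0 : R)^'.
  move=> A [e /= e0 HA]; apply: filterS (invSn_near e0) => n ne.
  have gE : grid n 1 = n.+1%:R^-1 :> R by rewrite /grid mul1r.
  apply: HA; last by rewrite gE invr_eq0 pnatr_eq0.
  by rewrite /ball_ /= sub0r normrN gE ger0_norm ?invr_ge0.
have := cvg_comp _ _ h0 lE; rewrite lT => H.
rewrite [X in _ --> X]mxE; apply: cvg_trans (cvgN H); apply: near_eq_cvg; near=> n.
have -> : (n.+1%:R *: (1 - expmx (grid n 1 *: T))) i j =
    n.+1%:R * ((1 : 'M[R]_p) i j - expmx (grid n 1 *: T) i j) by rewrite !mxE.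
rewrite -[LHS]/(- ((grid n 1)^-1 *
  (expmx ((grid n 1 * 1 + 0) *: T) i j - expmx (0 *: T) i j))).
by rewrite mulr1 addr0 expmx0 -mulrN opprB /grid mul1r invrK.
Unshelve. all: by end_near.
Qed.

(* The two discretized brackets multiply to a discrete double sum, because
   [e (j d) e (k d) (1 - e d) = e ((j + k) d) - e ((j + k + 1) d)]. *)
Lemma discrete_brackets (alpha : 'rV[R]_p) (t : 'cV[R]_p) (G H : nat -> R) n N :
  let d : R := n.+1%:R^-1 in
  let M (F : nat -> R) : 'M[R]_p :=
    \matrix_(i, j) (d * \sum_(l < N) expmx (grid n l *: T) i j * F l) in
  let q m := me_density alpha T t (grid n m) in
  ((alpha *m M G) *m (M H *m (n.+1%:R *: (1 - expmx (grid n 1 *: T))) *m t)) 0 0 =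
  d * \sum_(j < N) \sum_(k < N) G j * H k * (q (j + k)%N - q (j + k).+1).
Proof.
move=> d M q.
have ME F : M F = d *: \sum_(l < N) F l *: expmx (grid n l *: T).
  apply/matrixP => i j; rewrite !mxE summxE; congr (_ * _).
  by apply: eq_bigr => l _; rewrite mxE mulrC.
have qE m : q m = (alpha *m expmx (grid n m *: T) *m t) 0 0 by [].
have dn : d * n.+1%:R = 1 by rewrite mulVf.
have expE (i k : nat) : expmx (grid n i *: T) *m (expmx (grid n k *: T) *m
   (1 - expmx (grid n 1 *: T))) = expmx (grid n (i + k) *: T) - expmx (grid n (i + k).+1 *: T).
  by rewrite -[(i + k).+1]addn1 !gridD !expmxD !mulmxBr mulmx1 !mulmxA.
have main : (alpha *m M G) *m (M H *m (n.+1%:R *: (1 - expmx (grid n 1 *: T))) *m t) =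
  d *: \sum_(j < N) \sum_(k < N) (G j * H k) *:
   (alpha *m (expmx (grid n (j + k) *: T) - expmx (grid n (j + k).+1 *: T)) *m t).
  rewrite !ME !(=^~ scalemxAr, =^~ scalemxAl) !scalerA.
  rewrite [X in X *: _](_ : _ = d); last first.
    by rewrite -mulrA dn mulr1.
  congr (_ *: _).
  rewrite mulmx_sumr mulmx_suml; apply: eq_bigr => l _.
  rewrite !mulmx_suml mulmx_sumr; apply: eq_bigr => k _.
  rewrite !(=^~ scalemxAr, =^~ scalemxAl) !scalerA. congr (_ *: _).
  by rewrite -expE !mulmxA.
rewrite main mxE summxE; congr (_ * _); apply: eq_bigr => j _.
rewrite summxE; apply: eq_bigr => k _.
rewrite mxE !qE mulmxBr mulmxBl; congr (_ * _).
by rewrite mxE; congr (_ + _); rewrite mxE.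
Qed.

End MatrixLimits.

(** * Evaluation at the random time *)

Section RandomTime.
Context {d : measure_display} {Omega : measurableType d} {R : realType}.
Context {P : probability Omega R} {tau : Omega -> \bar R}.
Context {p : nat} {alpha : 'rV[R]_p} {T : 'M[R]_p} {t : 'cV[R]_p}.
Hypothesis T_stable : stable_mx T.
Hypothesis tau_ME : matrix_exponential_time P tau alpha T t.
Let pr (E : set Omega) : R := fine (P E).
Local Notation mu := (@lebesgue_measure R).
Local Notation dens := (me_density alpha T t).
Local Notation half a := (`]a, +oo[%classic : set R).

(** [fine] sends +oo to 0, so defective outcomes receive time 0 and have to be removed by the
    condition [tau w < +oo], as in [at_tauE]. *)
Definition real_time (tau : Omega -> \bar R) (w : Omega) : R := fine (tau w).

Definition at_tau (Q : R -> set Omega) : set Omega :=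
  [set w | exists2 u, tau w = u%:E & Q u w].

Lemma real_time_ge0 w : 0 <= real_time tau w.
Proof. by apply: fine_ge0; exact/ltW/(me_positive tau_ME). Qed.

Lemma at_tauE Q : at_tau Q =
  [set w | tau w < +oo]%E `&` [set w | Q (real_time tau w) w].
Proof.
apply/seteqP; split=> w.
  by move=> [u tu Qw]; rewrite /= /real_time tu ltry.
move=> [/= tf Qw]; exists (real_time tau w) => //.
rewrite /real_time fineK // ge0_fin_numE //.
exact/ltW/(me_positive tau_ME).
Qed.

Lemma measurable_real_time : measurable_fun setT (real_time tau).
Proof.
apply: (measurableT_comp _ (me_measurable tau_ME)).
exact: fine_measurable.
Qed.

Lemma measurable_tau_finite : measurable [set w | tau w < +oo]%E.
Proof.
rewrite -[X in measurable X]setTI.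
by apply: emeasurable_fun_infty_o => //; exact: (me_measurable tau_ME).
Qed.

Lemma measurable_at_tau_cst (C : set R) : measurable C ->
  measurable (at_tau (fun u => [set w | C u])).
Proof.
move=> mC; rewrite at_tauE; apply: measurableI; first exact: measurable_tau_finite.
by apply: measurable_set_pre => //; exact: measurable_real_time.
Qed.

Lemma pr_tau_cell n k :
  pr (at_tau (fun u => [set w | cell n k u])) = Rintegral mu (cell n k) dens.
Proof.
rewrite /pr /at_tau /= (me_law tau_ME); last exact: measurable_cell.
by rewrite setIidl //; exact: cell_sub.
Qed.

Section Evaluation.
Variables (Yn Zn : nat -> nat -> Omega -> R) (Y Z : R -> Omega -> R).
Hypothesis mYn : forall n k, measurable_fun setT (Yn n k).
Hypothesis mZn : forall n k, measurable_fun setT (Zn n k).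
Hypothesis YnY : forall u w, 0 <= u -> Yn n (next_index n u) w @[n --> \oo] --> Y u w.
Hypothesis ZnZ : forall u w, 0 <= u -> Zn n (next_index n u) w @[n --> \oo] --> Z u w.

Let near_step u : \forall n \near \oo, u < n.+1%:R :> R.
Proof.
exists (Num.truncn u).+1 => // n /= un.
by apply: lt_trans (truncnS_gt u) _; rewrite ltr_nat.
Qed.

(** Evaluation at a random time is a pointwise limit of finite sums of cell indicators times grid
    variables, which yields measurability without a joint measurability assumption on [V]. *)
Lemma measurable_at_real_time (V : R -> Omega -> R) (Vn : nat -> nat -> Omega -> R) :
  (forall n k, measurable_fun setT (Vn n k)) ->
  (forall u w, 0 <= u -> Vn n (next_index n u) w @[n --> \oo] --> V u w) ->
  measurable_fun setT (fun w => V (real_time tau w) w).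
Proof.
move=> mVn VnV.
apply: (@measurable_fun_cvg _ _ _ _ (fun n w => step_fun n (Vn n ^~ w) (real_time tau w))).
  move=> n; apply: measurable_sum => k; apply: measurable_funM => //.
  have mi : measurable_fun setT (\1_(cell n k) : R -> R).
    by apply: measurable_indic; exact: measurable_cell.
  exact: measurableT_comp mi measurable_real_time.
move=> w _; have u0 := real_time_ge0 w.
apply: cvg_trans (VnV _ w u0); apply: near_eq_cvg.
apply: filterS (near_step (real_time tau w)) => n un.
by rewrite step_funE // un.
Qed.

Let Yt w := Y (real_time tau w) w.
Let Zt w := Z (real_time tau w) w.
Let mYt : measurable_fun setT Yt. Proof. exact: measurable_at_real_time YnY. Qed.
Let mZt : measurable_fun setT Zt. Proof. exact: measurable_at_real_time ZnZ. Qed.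

Definition atoms (V : Omega -> R) : set R := [set a | P [set w | V w = a] != 0%E].

Lemma atoms_countable (V : Omega -> R) : measurable_fun setT V -> countable (atoms V).
Proof.
move=> mV; apply: (@countable_pos_prob _ _ _ P (fun a => [set w | V w = a])).
  by move=> a; apply: (measurable_set_pre mV (measurable_set1 a)).
by move=> a b _ _ [w [<- <-]].
Qed.

Hypothesis indep : forall n k j a b,
  pr (at_tau (fun u => [set w | cell n j u]) `&`
      [set w | half a (Yn n k w) /\ half b (Zn n k w)]) =
  pr (at_tau (fun u => [set w | cell n j u])) *
  pr [set w | half a (Yn n k w) /\ half b (Zn n k w)].

Lemma half_cvg (v : nat -> R) (l a : R) : v @ \oo --> l -> l != a ->
  \forall n \near \oo, half a (v n) <-> half a l.
Proof.
move=> /cvgrPdist_lt vl la; rewrite /= !in_itv /= !andbT.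
have e0 : 0 < `|l - a| by rewrite normr_gt0 subr_eq0.
apply: filterS (vl _ e0) => n; rewrite in_itv /= andbT.
case: (ltgtP l a) la => // h _; rewrite ltr_distlC.
  by rewrite ltr0_norm ?subr_lt0 // => /andP[_ h2]; split=> // h3; lra.
by rewrite gtr0_norm ?subr_gt0 // => /andP[h2 _]; split=> // h3; lra.
Qed.

(** By independence each term is the probability that [tau] lies in cell k while the pair, read at
    the right end of that cell, lies in the quadrant. The union over k converges to the event at
    [tau] off the ties Y = a or Z = b, which are null because the levels are not atoms. *)
Lemma cvg_at_tau a b : ~ atoms Yt a -> ~ atoms Zt b ->
  \sum_(k < step_size n) Rintegral mu (cell n k) dens *
     pr [set w | half a (Yn n k.+1 w) /\ half b (Zn n k.+1 w)] @[n --> \oo] -->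
  pr (at_tau (fun u => [set w | half a (Y u w) /\ half b (Z u w)])).
Proof.
move=> /negP; rewrite negbK => /eqP Ya0 /negP; rewrite negbK => /eqP Zb0.
pose En n k := [set w | half a (Yn n k w) /\ half b (Zn n k w)].
have mEn n k : measurable (En n k).
  by apply: measurableI; apply: measurable_set_pre => //; exact: measurable_itvoy.
pose C n k := at_tau (fun u => [set w | cell n k u]).
have mC n k : measurable (C n k) by apply: measurable_at_tau_cst; exact: measurable_cell.
pose A n := \big[setU/set0]_(k < step_size n) (C n k `&` En n k.+1).
have mA n : measurable (A n) by apply: bigsetU_measurable => k _; exact: measurableI.
have CE n k w : C n k w -> next_index n (real_time tau w) = k.+1.
  rewrite /C at_tauE => -[_]; rewrite /cell /= in_itv /= => /andP[]; exact: next_index_def.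
rewrite (_ : (fun n => _) = (fun n => pr (A n))); last first.
  apply/funext => n; rewrite /pr /A.
  rewrite (measure_semi_additive_ord_I _ (F := fun k => C n k `&` En n k.+1)) //.
  - rewrite (eq_bigr (fun k : 'I_(step_size n) => (pr (C n k `&` En n k.+1))%:E)).
      by rewrite sumEFin /=; apply: eq_bigr => k _; rewrite indep pr_tau_cell.
    by move=> k _; rewrite fineK // fin_num_measure //; exact: measurableI.
  - by move=> k _; exact: measurableI.
  - by move=> i j _ _ [w [[/CE + _] [/CE + _]]] => -> [].
  - exact: mA.
have AE n : A n = \bigcup_(k in `I_(step_size n)) (C n k `&` En n k.+1).
  by rewrite (bigcup_mkord _ (fun k => C n k `&` En n k.+1)).
(* On an infinite time neither the approximating events nor the limit event occur, so the defective
   mass drops out. *)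
have Ntau w : tau w = +oo%E -> forall n, ~ A n w.
  by move=> tw n; rewrite AE => -[k _ [[u]]]; rewrite tw.
have Ain n w : (tau w < +oo)%E -> real_time tau w < n.+1%:R ->
    A n w <-> En n (next_index n (real_time tau w)) w.
  move=> tf tn; have u0 := real_time_ge0 w; split.
    by rewrite AE => -[k _ [/CE -> ]].
  move=> Ew; rewrite AE.
  exists (next_index n (real_time tau w)).-1.
    rewrite /= -(lt_grid (R := R) n) grid_step_size.
    exact: le_lt_trans (next_index_le n u0) tn.
  split=> //; rewrite /C at_tauE; split=> //=.
  by rewrite /cell /= in_itv /= next_index_le // next_index_gt.
apply: (@cvg_pr _ _ _ P A _ ([set w | Yt w = a] `|` [set w | Zt w = b])).
- exact: mA.
- rewrite at_tauE; apply: measurableI; first exact: measurable_tau_finite.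
  by apply: measurableI; [apply: (measurable_set_pre mYt)|apply: (measurable_set_pre mZt)];
    exact: measurable_itvoy.
- by apply: measurableU; [apply: (measurable_set_pre mYt (measurable_set1 a))|
    apply: (measurable_set_pre mZt (measurable_set1 b))].
- rewrite null_set_setU //; [exact: (measurable_set_pre mYt (measurable_set1 a))|
    exact: (measurable_set_pre mZt (measurable_set1 b))].
- move=> w /= /not_orP[/eqP Yw /eqP Zw]; rewrite at_tauE => -[tf [Yh Zh]].
  have u0 := real_time_ge0 w.
  near=> n; apply/Ain => //; first by near: n; exact: near_step.
  have hY : half a (Yn n (next_index n (real_time tau w)) w) <-> half a (Yt w).
    by near: n; exact: half_cvg (YnY (w := w) u0) Yw.
  have hZ : half b (Zn n (next_index n (real_time tau w)) w) <-> half b (Zt w).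
    by near: n; exact: half_cvg (ZnZ (w := w) u0) Zw.
  by split; [apply/hY|apply/hZ].
- move=> w /= /not_orP[/eqP Yw /eqP Zw] nE.
  have u0 := real_time_ge0 w.
  case: (ltP (tau w) +oo%E) => [tf|]; last first.
    by rewrite leye_eq => /eqP tw; apply: nearW; exact: Ntau.
  near=> n; move=> /Ain H; apply: nE; rewrite at_tauE; split=> //.
  have [] := H tf _; first by near: n; exact: near_step.
  have hY : half a (Yn n (next_index n (real_time tau w)) w) <-> half a (Yt w).
    by near: n; exact: half_cvg (YnY (w := w) u0) Yw.
  have hZ : half b (Zn n (next_index n (real_time tau w)) w) <-> half b (Zt w).
    by near: n; exact: half_cvg (ZnZ (w := w) u0) Zw.
  by move=> /hY ? /hZ ?; split.
Unshelve. all: by end_near. Qed.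

Lemma at_tau_continuous_additive_l (B : set R) : measurable B ->
  continuous_additive (fun A => pr (at_tau (fun u => [set w | A (Y u w) /\ B (Z u w)]))).
Proof.
move=> mB; rewrite (_ : (fun A => _) = fun A =>
    pr (([set w | tau w < +oo]%E `&` [set w | B (Zt w)]) `&` Yt @^-1` A)).
  apply: continuous_additive_prob; last exact: mYt.
  apply: measurableI; first exact: measurable_tau_finite.
  exact: measurable_set_pre.
apply/funext => A; rewrite at_tauE; congr pr; apply/seteqP.
by split=> w /= [[]] // ? [? ?]; split.
Qed.

Lemma at_tau_continuous_additive_r (A : set R) : measurable A ->
  continuous_additive (fun B => pr (at_tau (fun u => [set w | A (Y u w) /\ B (Z u w)]))).
Proof.
move=> mA; rewrite (_ : (fun B => _) = fun B =>
    pr (([set w | tau w < +oo]%E `&` [set w | A (Yt w)]) `&` Zt @^-1` B)).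
  apply: continuous_additive_prob; last exact: mZt.
  apply: measurableI; first exact: measurable_tau_finite.
  exact: measurable_set_pre.
apply/funext => B; rewrite at_tauE; congr pr; apply/seteqP.
by split=> w /= [[]] // ? [? ?]; split.
Qed.

Lemma measurable_at_tau A B : measurable A -> measurable B ->
  measurable (at_tau (fun u => [set w | A (Y u w) /\ B (Z u w)])).
Proof.
move=> mA mB; rewrite at_tauE; apply: measurableI; first exact: measurable_tau_finite.
by apply: measurableI; [exact: (measurable_set_pre mYt)|exact: (measurable_set_pre mZt)].
Qed.

End Evaluation.
End RandomTime.

Arguments real_time {d Omega R} tau w.
Arguments at_tau {d Omega R} tau Q _.
Arguments atoms {d Omega R} P V _.

(** * Passage to the limit *)

Section BracketLimits.
Context {d : measure_display} {Omega : measurableType d} {R : realType}.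
Variable P : probability Omega R.
Context {p : nat}.
Variable T : 'M[R]_p.
Hypothesis T_stable : stable_mx T.
Let pr (E : set Omega) : R := fine (P E).
Local Notation mu := (@lebesgue_measure R).
Local Notation D := (`[0, +oo[%classic : set R).
Local Notation half a := (`]a, +oo[%classic : set R).

Lemma half_preimage (V : Omega -> R) a : [set w | half a (V w)] = [set w | a < V w].
Proof. by apply/seteqP; split=> w /=; rewrite in_itv /= andbT. Qed.

Variable Z : R -> Omega -> R.
Hypothesis mZ : forall u, 0 <= u -> measurable_fun setT (Z u).
Hypothesis rcZ : forall w (t : R), 0 <= t -> Z s w @[s --> t^'+] --> Z t w.
Hypothesis llZ : forall w (t : R), 0 < t -> cvg (Z s w @[s --> t^'-]).

Lemma measurable_expmx i j E : measurable_fun E (fun u : R => expmx (u *: T) i j).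
Proof.
by apply: measurable_funTS; apply: continuous_measurable_fun; exact: continuous_expmx.
Qed.

Lemma cvg_riemann_transform a i j :
  n.+1%:R^-1 * (\sum_(l < step_size n) expmx (grid n l *: T) i j *
    pr [set w | half a (grid_max (Z^~ w) n l)]) @[n --> \oo] -->
  exp_transform T (fun u => pr [set w | half a (path_sup (Z^~ w) u)]) i j.
Proof.
rewrite mxE.
pose c n k := pr [set w | half a (grid_max (Z^~ w) n k)].
have c1 n k : `|c n k| <= 1.
  apply: pr_norm; apply: measurable_set_pre; last exact: measurable_itvoy.
  exact: measurable_grid_max.
have [Ex cE ExP] := cvg_pr_grid_max_gt P mZ rcZ llZ a.
have eb := exp_bounded_expmx T_stable i j.
have mw := @measurable_expmx i j D.
have cv1 := cell_sums_riemann (@continuous_expmx R p T i j) eb c1.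
have cv2 := @cvg_cell_sums R (fun u => expmx (u *: T) i j) c
  (fun u => pr [set w | half a (path_sup (Z^~ w) u)]) Ex cE mw eb.
have {}cv2 := cv2 _ c1 _.
have {}cv2 : \sum_(k < step_size n) Rintegral mu (cell n k) (fun u => expmx (u *: T) i j) *
    c n k.+1 @[n --> \oo] --> Rintegral mu D (fun u => expmx (u *: T) i j *
    pr [set w | half a (path_sup (Z^~ w) u)]).
  apply: cv2.
    apply: measurable_law; last exact: measurable_itvoy.
      by move=> u u0; exact: measurable_path_sup.
    exact: measurable_pr_sup_gt.
  move=> u u0 Eu; rewrite [pr _](congr1 pr (half_preimage (fun w => path_sup (Z^~ w) u) a)).
  rewrite (_ : (fun n => c n _) =
    fun n => pr [set w | a < grid_max (Z^~ w) n (next_index n u)]); first exact: ExP.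
  apply/funext => n.
  exact: (congr1 pr (half_preimage (fun w => grid_max (Z^~ w) n (next_index n u)) a)).
rewrite -[X in _ --> X]subr0.
(* The Riemann sum is the cell sum, whose limit is the integral, minus their vanishing
   difference. *)
rewrite (_ : (fun n => _) = (fun n =>
  \sum_(k < step_size n) Rintegral mu (cell n k) (fun u => expmx (u *: T) i j) * c n k.+1 -
  (\sum_(k < step_size n) Rintegral mu (cell n k) (fun u => expmx (u *: T) i j) * c n k.+1 -
   n.+1%:R^-1 * \sum_(l < step_size n) expmx (grid n l *: T) i j * c n l))).
  exact: cvgB cv2 cv1.
by apply/funext => n; rewrite subKr.
Qed.

Lemma transform_continuous_additive i j :
  continuous_additive (fun A =>
    exp_transform T (fun u => pr [set w | A (path_sup (Z^~ w) u)]) i j).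
Proof.
have [H1 H2] := weighted_law_continuous_additive
  (fun u u0 => measurable_path_sup mZ rcZ llZ u0)
  (measurable_pr_sup_gt P mZ rcZ llZ) (@measurable_expmx i j D) (exp_bounded_expmx T_stable i j).
split=> [A B mA mB AB|F mF ndF]; first by rewrite !mxE; exact: H1.
by rewrite mxE; under eq_cvg do rewrite mxE; exact: H2.
Qed.

Lemma transform_converges A : measurable A ->
  exp_transform_converges T (fun u => pr [set w | A (path_sup (Z^~ w) u)]).
Proof.
move=> mA i j; apply: (weighted_law_integrable (f := fun u w => path_sup (Z^~ w) u)) => //.
- by move=> u u0; exact: measurable_path_sup.
- by move=> a; exact: measurable_pr_sup_gt.
- exact: measurable_expmx.
- exact: exp_bounded_expmx.
Qed.

End BracketLimits.

(** * The factorization on half-lines and its extension to Borel sets *)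

Section WienerHopf.
Context {R : realType} {d : measure_display} {Omega : measurableType d}.
Context {P : probability Omega R} {X : R -> Omega -> R} {tau : Omega -> \bar R}.
Context {p : nat} {alpha : 'rV[R]_p} {T : 'M[R]_p} {t : 'cV[R]_p}.
Hypothesis X_levy : levy_process P X.
Hypothesis T_stable : stable_mx T.
Hypothesis tau_ME : matrix_exponential_time P tau alpha T t.
Hypothesis tau_X_indep : independent_of_process P X tau.
Let pr (E : set Omega) : R := fine (P E).
Local Notation mu := (@lebesgue_measure R).
Local Notation half a := (`]a, +oo[%classic : set R).

Let NX (u : R) (w : Omega) : R := - X u w.

(** Reduces the second bracket to running suprema of -X, whose paths are again right-continuous with
    left limits. *)
Lemma neg_run_inf u w : - run_inf X u w = path_sup (NX^~ w) u.
Proof.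
rewrite /run_inf /inf opprK /path_sup; congr sup.
by rewrite image_comp.
Qed.

Lemma neg_inf_probE B :
  neg_inf_prob P X B = fun u => pr [set w | B (path_sup (NX^~ w) u)].
Proof.
apply/funext => u; rewrite /neg_inf_prob; congr (fine (P _)).
by apply/seteqP; split=> w /=; rewrite neg_run_inf.
Qed.

Let mX u : 0 <= u -> measurable_fun setT (X u).
Proof. exact: (levy_measurable X_levy). Qed.

Let rcX w (s : R) : 0 <= s -> X v w @[v --> s^'+] --> X s w.
Proof. exact: (levy_right_cont X_levy). Qed.

Let llX w (s : R) : 0 < s -> cvg (X v w @[v --> s^'-]).
Proof. exact: (levy_left_lim X_levy). Qed.

Let mNX u : 0 <= u -> measurable_fun setT (NX u).
Proof. by move=> u0; apply: measurableT_comp => //; exact: mX. Qed.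

Let rcNX w (s : R) : 0 <= s -> NX v w @[v --> s^'+] --> NX s w.
Proof. by move=> s0; apply: cvgN; exact: rcX. Qed.

Let llNX w (s : R) : 0 < s -> cvg (NX v w @[v --> s^'-]).
Proof. by move=> s0; apply: is_cvgN; exact: llX. Qed.

Let bracket_product A B : R :=
  (sup_bracket P X alpha T A *m inf_bracket P X T t B) 0 0.

(** Three sums are compared: [s] with exact cell integrals, its Riemann sum [r], and the discretized
    product of brackets [v]. Continuity of the density makes s - r vanish, the grid factorization
    with exponential decay makes v - r vanish, and v has the stated limit. *)
Lemma cvg_sup_event_sums a b :
  \sum_(k < step_size n) Rintegral mu (cell n k) (me_density alpha T t) *
    pr (sup_event X n k.+1 (half a) (half b)) @[n --> \oo] -->
  bracket_product (half a) (half b).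
Proof.
have mh c : measurable (half c) by exact: measurable_itvoy.
pose F n k := pr (sup_event X n k (half a) (half b)).
pose G n k := pr [set w | half a (grid_sup X n k w)].
pose H n k := pr [set w | half b (grid_neg_inf X n k w)].
pose q n m := me_density alpha T t (grid n m).
have F01 n k : 0 <= F n k <= 1.
  by apply: pr_le1; exact: (measurable_sup_event X_levy).
have G01 n k : 0 <= G n k <= 1.
  by apply: pr_le1; apply: measurable_set_pre => //; exact: (measurable_grid_sup X_levy).
have H01 n k : 0 <= H n k <= 1.
  by apply: pr_le1; apply: measurable_set_pre => //; exact: (measurable_grid_neg_inf X_levy).
have eb := exp_bounded_me_density T_stable alpha t.
have riemann : \sum_(k < step_size n) Rintegral mu (cell n k) (me_density alpha T t) * F n k.+1
    - n.+1%:R^-1 * (\sum_(m < step_size n) q n m * F n m) @[n --> \oo] --> (0 : R).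
  apply: cell_sums_riemann => //; first exact: continuous_me_density.
  by move=> n k; have /andP[f0 f1] := F01 n k; rewrite ger0_norm.
have double : n.+1%:R^-1 * (\sum_(j < step_size n) \sum_(k < step_size n)
    G n j * H n k * (q n (j + k)%N - q n (j + k).+1)) -
    n.+1%:R^-1 * (\sum_(m < step_size n) q n m * F n m) @[n --> \oo] --> (0 : R).
  have [r r0 [C C0 HC]] := eb.
  have cub : 3 * C * (n.+1%:R ^+ 3 * expR (- r * n.+1%:R)) @[n --> \oo] --> (0 : R).
    by rewrite -[X in _ --> X](mulr0 (3 * C)); apply: cvgMl_tmp; exact: cubic_expR_cvg0.
  apply/cvgrPdist_le => e e0.
  move/cvgrPdist_le : cub => /(_ e e0); apply: filterS => n.
  rewrite !sub0r !normrN -mulrBr => le; rewrite normrM ger0_norm ?invr_ge0 //.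
  (* Indices from (n + 1)^2 on correspond to times at or beyond the horizon n + 1. *)
  have qe m : (step_size n <= m)%N -> `|q n m| <= C * expR (- r * n.+1%:R).
    move=> Nm; apply: le_trans (HC _ (grid_ge0 n m)) _.
    rewrite ler_wpM2l // ler_expR !mulNr lerN2 ler_pM2l //.
    by rewrite -(grid_step_size (R := R)) le_grid.
  have fz m : \sum_(k < m.+1) F n k = conv (G n) (H n) m.
    exact: (grid_factorization X_levy).
  have df := discrete_factorization (F01 n) (G01 n) (H01 n) fz qe.
  apply: le_trans (ler_wpM2l _ df) _; first by rewrite invr_ge0.
  apply: le_trans le; apply: le_trans (ler_norm _).
  rewrite /step_size !natrM le_eqVlt; apply/orP; left; apply/eqP.
  have n0 : n.+1%:R != 0 :> R by rewrite pnatr_eq0.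
  by field.
have prod : n.+1%:R^-1 * (\sum_(j < step_size n) \sum_(k < step_size n)
    G n j * H n k * (q n (j + k)%N - q n (j + k).+1)) @[n --> \oo] -->
    bracket_product (half a) (half b).
  under eq_cvg do rewrite -discrete_brackets.
  apply: cvg_mulmx_entries => i j.
    apply: cvg_mulmx_entries => {i j} i j; first exact: cvg_cst.
    under eq_cvg do rewrite mxE.
    exact: (@cvg_riemann_transform _ _ _ P _ _ T_stable X mX rcX llX a i j).
  apply: cvg_mulmx_entries => {i j} i j; last exact: cvg_cst.
  apply: cvg_mulmx_entries => {i j} i j; last exact: expmx_difference_quotient.
  under eq_cvg do rewrite mxE.
  rewrite neg_inf_probE.
  exact: (@cvg_riemann_transform _ _ _ P _ _ T_stable NX mNX rcNX llNX b i j).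
pose s n := \sum_(k < step_size n) Rintegral mu (cell n k) (me_density alpha T t) * F n k.+1.
pose r n := n.+1%:R^-1 * (\sum_(m < step_size n) q n m * F n m).
pose v n := n.+1%:R^-1 * (\sum_(j < step_size n) \sum_(k < step_size n)
    G n j * H n k * (q n (j + k)%N - q n (j + k).+1)).
rewrite -[X in _ --> X]add0r -[X in _ --> X + _]subr0.
rewrite (_ : (fun n => _) = (fun n => (s n - r n - (v n - r n)) + v n)).
  exact: cvgD (cvgB riemann double) prod.
by apply/funext => n; rewrite -/(s n); ring.
Qed.

(** Generates the sigma-algebra of the whole path. Independence from [tau] is stated for it, so grid
    functionals have to be measurable with respect to it and not only for the ambient structure. *)
Let full : set (set Omega) :=
  \bigcup_(v in (`[0, +oo[%classic : set R)) preimage_set_system setT (X v) measurable.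

Lemma measurable_grid_full n k :
  measurable_fun setT (X (grid n k) : g_sigma_algebraType full -> R).
Proof. by apply: measurable_past; rewrite /= in_itv /= grid_ge0. Qed.

Lemma measurable_grid_sup_full n k :
  measurable_fun setT (grid_sup X n k : g_sigma_algebraType full -> R).
Proof.
apply: measurable_bigmax => [|j]; last exact: measurable_grid_full.
by apply: (@measurable_past _ _ _ X `[0, +oo[); rewrite /= in_itv /= lexx.
Qed.

Lemma measurable_grid_neg_inf_full n k :
  measurable_fun setT (grid_neg_inf X n k : g_sigma_algebraType full -> R).
Proof.
apply: measurable_bigmax => [|j]; apply: measurableT_comp => //; last exact: measurable_grid_full.
by apply: (@measurable_past _ _ _ X `[0, +oo[); rewrite /= in_itv /= lexx.
Qed.

Lemma full_measurable E : (<<s full >>) E -> measurable E.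
Proof.
apply: smallest_sub; first exact: sigma_algebra_measurable.
move=> A [v /=]; rewrite in_itv /= andbT => v0 [B mB <-].
exact: (mX v0).
Qed.

Lemma tau_process_indep (U V : Omega -> R) n j a b :
  measurable_fun setT (U : g_sigma_algebraType full -> R) ->
  measurable_fun setT (V : g_sigma_algebraType full -> R) ->
  pr (at_tau tau (fun u => [set w | cell n j u]) `&`
      [set w | half a (U w) /\ half b (V w)]) =
  pr (at_tau tau (fun u => [set w | cell n j u])) *
  pr [set w | half a (U w) /\ half b (V w)].
Proof.
move=> mU mV.
have sE : (<<s full >>) [set w | half a (U w) /\ half b (V w)].
  rewrite -[<<s full >>]/(@measurable _ (g_sigma_algebraType full)).
  by apply: measurableI; apply: measurable_set_pre => //; exact: measurable_itvoy.
have mC : measurable (at_tau tau (fun u => [set w | cell n j u])).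
  by apply: (measurable_at_tau_cst tau_ME); exact: measurable_cell.
have sC : preimage_set_system setT tau measurable
    (at_tau tau (fun u => [set w | cell n j u])).
  (* [tau] takes extended values: the cell is embedded among them, which leaves out +oo. *)
  exists (EFin @` cell n j); first by apply: measurable_image_EFin; exact: measurable_cell.
  rewrite setTI; apply/seteqP; split=> w /=.
    by move=> [u cu tu]; exists u.
  by move=> [u tu cu]; exists u.
rewrite setIC mulrC; apply: prM => //; first exact: full_measurable.
exact: tau_X_indep.
Qed.

Let S_ u w := run_sup X u w.
Let I_ u w := - run_inf X u w.
Let SX u w := run_sup X u w - X u w.
Let XI u w := X u w - run_inf X u w.

Let SXn n k w := grid_sup X n k w - X (grid n k) w.
Let XIn n k w := X (grid n k) w + grid_neg_inf X n k w.

Let cvgS u w : 0 <= u -> grid_sup X n (next_index n u) w @[n --> \oo] --> S_ u w.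
Proof. exact: (@cvg_grid_max_path _ _ _ X rcX llX). Qed.

Let cvgI u w : 0 <= u -> grid_neg_inf X n (next_index n u) w @[n --> \oo] --> I_ u w.
Proof.
move=> u0; rewrite /I_ neg_run_inf.
exact: (@cvg_grid_max_path _ _ _ NX rcNX llNX).
Qed.

Let cvgX u w : 0 <= u -> X (grid n (next_index n u)) w @[n --> \oo] --> X u w.
Proof. by move=> u0; apply: (right_continuous_next_grid (x := X^~ w)) => //; exact: rcX. Qed.

Let cvgSX u w : 0 <= u -> SXn n (next_index n u) w @[n --> \oo] --> SX u w.
Proof. by move=> u0; apply: cvgB; [exact: cvgS|exact: cvgX]. Qed.

Let cvgXI u w : 0 <= u -> XIn n (next_index n u) w @[n --> \oo] --> XI u w.
Proof. by move=> u0; apply: cvgD; [exact: cvgX|exact: cvgI]. Qed.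

Let mS n k : measurable_fun setT (grid_sup X n k).
Proof. exact: (measurable_grid_sup X_levy). Qed.

Let mI n k : measurable_fun setT (grid_neg_inf X n k).
Proof. exact: (measurable_grid_neg_inf X_levy). Qed.

Let mSX n k : measurable_fun setT (SXn n k).
Proof. by apply: measurable_funB; [exact: mS|exact: (measurable_grid X_levy)]. Qed.

Let mXI n k : measurable_fun setT (XIn n k).
Proof. by apply: measurable_funD; [exact: (measurable_grid X_levy)|exact: mI]. Qed.

Lemma sup_bracket_continuous_additive j :
  continuous_additive (fun A => sup_bracket P X alpha T A 0 j).
Proof.
rewrite (_ : (fun A => _) = fun A =>
  \sum_i alpha 0 i * exp_transform T (sup_prob P X A) i j); last first.
  by apply/funext => A; rewrite mxE.
apply: continuous_additive_sum => i; apply: continuous_additiveZ.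
exact: (@transform_continuous_additive _ _ _ P _ _ T_stable X mX rcX llX).
Qed.

Lemma inf_bracket_continuous_additive i :
  continuous_additive (fun B => inf_bracket P X T t B i 0).
Proof.
rewrite (_ : (fun B => _) = fun B =>
  \sum_j ((- T) *m t) j 0 * exp_transform T (neg_inf_prob P X B) i j); last first.
  apply/funext => B; rewrite /inf_bracket -mulmxA mxE.
  by apply: eq_bigr => j _; rewrite mulrC.
apply: continuous_additive_sum => j; apply: continuous_additiveZ.
under eq_fun do rewrite neg_inf_probE.
exact: (@transform_continuous_additive _ _ _ P _ _ T_stable NX mNX rcNX llNX).
Qed.

Lemma bracket_product_additive_l B :
  continuous_additive (fun A => bracket_product A B).
Proof.
rewrite /bracket_product (_ : (fun A => _) = fun A =>
  \sum_j inf_bracket P X T t B j 0 * sup_bracket P X alpha T A 0 j); last first.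
  by apply/funext => A; rewrite mxE; apply: eq_bigr => j _; rewrite mulrC.
apply: continuous_additive_sum => j; apply: continuous_additiveZ.
exact: sup_bracket_continuous_additive.
Qed.

Lemma bracket_product_additive_r A :
  continuous_additive (fun B => bracket_product A B).
Proof.
rewrite /bracket_product (_ : (fun B => _) = fun B =>
  \sum_j sup_bracket P X alpha T A 0 j * inf_bracket P X T t B j 0); last first.
  by apply/funext => B; rewrite mxE.
apply: continuous_additive_sum => j; apply: continuous_additiveZ.
exact: inf_bracket_continuous_additive.
Qed.

(** One variable is freed at a time: with an admissible half-line in the second slot, the first
    extends to Borel sets; with that Borel set fixed, the second one follows. *)
Lemma product_extension (p_ : set R -> set R -> R) (E1 E2 : set R) :
  countable E1 -> countable E2 ->
  (forall B, measurable B -> continuous_additive (fun A => p_ A B)) ->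
  (forall A, measurable A -> continuous_additive (fun B => p_ A B)) ->
  (forall a b, ~ E1 a -> ~ E2 b -> p_ (half a) (half b) = bracket_product (half a) (half b)) ->
  forall A B, measurable A -> measurable B -> p_ A B = bracket_product A B.
Proof.
move=> c1 c2 ca1 ca2 H A B mA mB.
apply: (continuous_additive_eq_half_lines c2 (ca2 _ mA) (bracket_product_additive_r A) _ mB).
move=> b nb.
have mb := measurable_itvoy b.
apply: (continuous_additive_eq_half_lines c1 (ca1 _ mb) (bracket_product_additive_l _) _ mA).
by move=> a na; exact: H.
Qed.

Lemma sup_factorization A B : measurable A -> measurable B ->
  P (at_tau tau (fun u => [set w | A (S_ u w) /\ B (SX u w)])) = (bracket_product A B)%:E.
Proof.
move=> mA mB.
rewrite -[LHS]fineK; last first.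
  by apply: fin_num_measure; exact: (measurable_at_tau tau_ME mS mSX cvgS cvgSX).
congr (_%:E); move: A B mA mB.
apply: (@product_extension
  (fun A B => pr (at_tau tau (fun u => [set w | A (S_ u w) /\ B (SX u w)])))
  (atoms P (fun w => S_ (real_time tau w) w)) (atoms P (fun w => SX (real_time tau w) w))).
- by apply: atoms_countable; exact: (measurable_at_real_time tau_ME mS cvgS).
- by apply: atoms_countable; exact: (measurable_at_real_time tau_ME mSX cvgSX).
- by move=> B mB; exact: (at_tau_continuous_additive_l tau_ME mS mSX cvgS cvgSX).
- by move=> A mA; exact: (at_tau_continuous_additive_r tau_ME mS mSX cvgS cvgSX).
move=> a b na nb.
have l1 := cvg_at_tau tau_ME mS mSX cvgS cvgSX _ na nb.
have l2 := @cvg_sup_event_sums a b.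
(* The same cell sums converge to both sides, and limits are unique. *)
rewrite -(cvg_lim (@Rhausdorff R) l2).
apply/esym/(cvg_lim (@Rhausdorff R)); apply: l1 => n k j a' b'.
apply: tau_process_indep; first exact: measurable_grid_sup_full.
by apply: measurable_funB; [exact: measurable_grid_sup_full|exact: measurable_grid_full].
Qed.

Lemma inf_factorization A B : measurable A -> measurable B ->
  P (at_tau tau (fun u => [set w | A (XI u w) /\ B (I_ u w)])) = (bracket_product A B)%:E.
Proof.
move=> mA mB.
rewrite -[LHS]fineK; last first.
  by apply: fin_num_measure; exact: (measurable_at_tau tau_ME mXI mI cvgXI cvgI).
congr (_%:E); move: A B mA mB.
apply: (@product_extension
  (fun A B => pr (at_tau tau (fun u => [set w | A (XI u w) /\ B (I_ u w)])))
  (atoms P (fun w => XI (real_time tau w) w)) (atoms P (fun w => I_ (real_time tau w) w))).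
- by apply: atoms_countable; exact: (measurable_at_real_time tau_ME mXI cvgXI).
- by apply: atoms_countable; exact: (measurable_at_real_time tau_ME mI cvgI).
- by move=> B mB; exact: (at_tau_continuous_additive_l tau_ME mXI mI cvgXI cvgI).
- by move=> A mA; exact: (at_tau_continuous_additive_r tau_ME mXI mI cvgXI cvgI).
move=> a b na nb.
have l1 := cvg_at_tau tau_ME mXI mI cvgXI cvgI _ na nb.
have := @cvg_sup_event_sums a b.
(* Reversal of the increments turns the sums for the infimum into those for the supremum, whose
   limit is already known. *)
rewrite (_ : (fun n => _) = fun n => \sum_(k < step_size n)
    Rintegral mu (cell n k) (me_density alpha T t) *
    pr (inf_event X n k.+1 (half a) (half b))); last first.
  apply/funext => n; apply: eq_bigr => k _; congr (_ * _).
  by apply: (pr_sup_inf_event X_levy); exact: measurable_itvoy.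
move=> l2; rewrite -(cvg_lim (@Rhausdorff R) l2).
apply/esym/(cvg_lim (@Rhausdorff R)); apply: l1 => n k j a' b'.
apply: tau_process_indep; last exact: measurable_grid_neg_inf_full.
by apply: measurable_funD; [exact: measurable_grid_full|exact: measurable_grid_neg_inf_full].
Qed.

End WienerHopf.

Theorem proposition10 (R : realType) (d : measure_display)
    (Omega : measurableType d) (P : probability Omega R)
    (X : R -> Omega -> R) (tau : Omega -> \bar R)
    (p : nat) (alpha : 'rV[R]_p) (T : 'M[R]_p) (t : 'cV[R]_p)
    (X_levy : levy_process P X)
    (T_stable : stable_mx T)
    (tau_ME : matrix_exponential_time P tau alpha T t)
    (tau_X_indep : independent_of_process P X tau) :
  (forall A B : set R, measurable A -> measurable B ->
    A `<=` `[0, +oo[ -> B `<=` `[0, +oo[ ->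
    [/\ P [set w | exists2 u, tau w = u%:E &
             A (run_sup X u w) /\ B (run_sup X u w - X u w)] =
        P [set w | exists2 u, tau w = u%:E &
             A (X u w - run_inf X u w) /\ B (- run_inf X u w)],
        P [set w | exists2 u, tau w = u%:E &
             A (X u w - run_inf X u w) /\ B (- run_inf X u w)] =
        ((sup_bracket P X alpha T A *m inf_bracket P X T t B) 0 0)%:E,
        exp_transform_converges T (sup_prob P X A) &
        exp_transform_converges T (neg_inf_prob P X B)]) /\
  (forall j : 'I_p, finite_signed_measure_on `[0, +oo[
     (fun A => sup_bracket P X alpha T A 0 j)) /\
  (forall i : 'I_p, finite_signed_measure_on `[0, +oo[
     (fun B => inf_bracket P X T t B i 0)).
Proof.
split; [move=> A B mA mB _ _|split].
- have supE := sup_factorization X_levy T_stable tau_ME tau_X_indep mA mB.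
  have infE := inf_factorization X_levy T_stable tau_ME tau_X_indep mA mB.
  split.
  + by rewrite -[LHS]/(P (at_tau tau _)) supE -infE.
  + exact: infE.
  + apply: (@transform_converges _ _ _ P _ _ T_stable X) => //.
    * exact: (levy_measurable X_levy).
    * exact: (levy_right_cont X_levy).
    * exact: (levy_left_lim X_levy).
  + rewrite neg_inf_probE.
    apply: (@transform_converges _ _ _ P _ _ T_stable (fun u w => - X u w)) => //.
    * move=> u u0; apply: measurableT_comp => //; exact: (levy_measurable X_levy).
    * by move=> w s s0; apply: cvgN; exact: (levy_right_cont X_levy).
    * by move=> w s s0; apply: is_cvgN; exact: (levy_left_lim X_levy).
- move=> j.
  have [nu nuE] := continuous_additive_charge
    (sup_bracket_continuous_additive (alpha := alpha) X_levy T_stable j).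
  by exists nu => A _ _; exact: nuE.
- move=> i.
  have [nu nuE] := continuous_additive_charge
    (inf_bracket_continuous_additive (t := t) X_levy T_stable i).
  by exists nu => A _ _; exact: nuE.
Qed.
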